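(* Let $\overline{\varepsilon}>0$, $n\ge0$, $\vec{s}\in\mathbb{R}^{2n+1}$ with $s_n^{\uparrow}<s_n^{\downarrow}<\cdots<s_1^{\downarrow}<s_0^{\uparrow}$, and $\vec{\chi}\in\mathbb{R}^n$ be such that the multi-phase solution $v^{\vec{s},\vec{\chi}}=v^{\vec{s},\vec{\chi}}(x,t;\overline{\varepsilon})$ is $2\pi$-periodic in $x$. Then for all $u\in\mathbb{C}\setminus\mathbb{R}$ and all $t$, under the identification $w=e^{\mathbf{i}x}$, $$\Phi^{BA}(u,e^{\mathbf{i}x}|v^{\vec{s},\vec{\chi}};\overline{\varepsilon})=T^{\uparrow}(u|\vec{s})\,\Phi_+(u,x|v^{\vec{s},\vec{\chi}};\overline{\varepsilon}),$$ i.e. the Nazarov–Sklyanin Baker–Akhiezer function $\Phi^{BA}$ at $v=v^{\vec{s},\vec{\chi}}$ equals the periodic part $\Phi_+$ of the Dobrokhotov–Krichever multi-phase Baker–Akhiezer function $\Psi_+$ up to the factor $$T^{\uparrow}(u|\vec{s})=\frac{(u-s_n^{\downarrow})\cdots(u-s_1^{\downarrow})}{(u-s_n^{\uparrow})\cdots(u-s_1^{\uparrow})(u-s_0^{\uparrow})},$$ which depends only on $u$ and $\vec{s}$.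
   Context: **Multi-phase solutions.** For $\vec{s},\vec{\chi}$ as in the claim, $$v^{\vec{s},\vec{\chi}}(x,t;\overline{\varepsilon})=s_n^{\uparrow}-\sum_{i=1}^n(s_{i-1}^{\uparrow}-s_i^{\downarrow})+2\overline{\varepsilon}\,\mathrm{Im}\,\partial_x\log\det M(x,t),$$ where $M(x,t)$ is the $n\times n$ matrix with entries ($\delta_{ij}$ the Kronecker delta) $$M_{ij}(x,t)=\frac{1}{s_{i-1}^{\uparrow}-s_j^{\downarrow}}\Big(-1+\delta_{ij}Z_i\,e^{\mathbf{i}\frac{s_{i-1}^{\uparrow}-s_i^{\downarrow}}{\overline{\varepsilon}}\left(x-\chi_i-\frac12(s_i^{\downarrow}+s_{i-1}^{\uparrow})t\right)}\Big),$$ $$Z_i=\sqrt{\frac{s_{i-1}^{\uparrow}-s_n^{\uparrow}}{s_i^{\downarrow}-s_n^{\uparrow}}}\prod_{j\ne i}\sqrt{\frac{(s_i^{\downarrow}-s_j^{\downarrow})(s_{i-1}^{\uparrow}-s_{j-1}^{\uparrow})}{(s_{i-1}^{\uparrow}-s_j^{\downarrow})(s_i^{\downarrow}-s_{j-1}^{\uparrow})}}.$$ **Nazarov–Sklyanin Baker–Akhiezer function.** Let $H_\bullet$ be the closure of $\mathbb{C}[w]$ in $L^2(\mathbb{T},dx/2\pi)$, $w=e^{\mathbf{i}x}$, with orthogonal projection $\pi_\bullet$ and orthonormal basis $|h\rangle=w^h$, $h\ge0$. For bounded real $2\pi$-periodic $v$, $L_\bullet(v;\overline{\varepsilon})=-\overline{\varepsilon}D_\bullet+\pi_\bullet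 L(v)\pi_\bullet$ is self-adjoint, with $D_\bullet|h\rangle=h|h\rangle$ and $L(v)$ multiplication by $v$. For $u\in\mathbb{C}\setminus\mathbb{R}$, $\Phi^{BA}(u,w|v;\overline{\varepsilon})=\sum_{h=0}^\infty\langle h|(u-L_\bullet(v;\overline{\varepsilon}))^{-1}|0\rangle\,w^h$. **Dobrokhotov–Krichever functions.** For $u\in\mathbb{C}\setminus\mathbb{R}$ and $x,t\in\mathbb{R}$, $\Psi_\pm(u,x|v^{\vec{s},\vec{\chi}};\overline{\varepsilon})$ (dependence on $t$ suppressed) denote the two branches of the multi-phase Baker–Akhiezer function constructed by Dobrokhotov and Krichever. They are smooth in $x$ and have the following properties, which are all that is used about them: (i) as functions of $x\in\mathbb{R}$ they extend to analytic functions of $z$ in $\mathbb{C}_\pm=\{\pm\mathrm{Im}\,z>0\}$ (smoothly up to the boundary $\mathbb{R}$); (ii) as $\mathrm{Im}\,z\to\pm\infty$, $\Psi_\pm(u,z)=\big(1+O(e^{-\alpha|\mathrm{Im}\,z|/\overline{\varepsilon}})\big)e^{\frac{\mathbf{i}}{\overline{\varepsilon}}(uz-u^2t)}$ for some $\alpha>0$ depending only on $\vec{s}$; (iii) when $v^{\vec{s},\vec{\chi}}$ is $2\pi$-periodic in $x$, $\Psi_\pm(u,x)=\Phi_\pm(u,x|v^{\vec{s},\vec{\chi}};\overline{\varepsilon})\,e^{\frac{\mathbf{i}}{\overline{\varepsilon}}(ux-u^2t)}$ with $\Phi_\pm$ $2\pi$-periodic in $x$; (iv) with $D=\frac{1}{\mathbf{i}}\frac{d}{dx}$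 and $L(v)$ multiplication by $v$, $\ -\big(-\overline{\varepsilon}D+L(v^{\vec{s},\vec{\chi}})\big)\Psi_+=\frac{1}{T^{\uparrow}(u|\vec{s})}\Psi_-$. *)

(* Defs.v *)
From HB Require Import structures.
From mathcomp Require Export all_boot all_order all_algebra.
From mathcomp Require Export complex.
From mathcomp Require Export all_classical all_reals all_analysis.

Set Implicit Arguments.
Unset Strict Implicit.
Unset Printing Implicit Defensive.

Export Order.TTheory GRing.Theory Num.Theory.
Export numFieldNormedType.Exports.

Local Open Scope classical_set_scope.
Local Open Scope ring_scope.
Local Open Scope complex_scope.

(* [R[i]^o] is the field of complex numbers R[i] seen
   as a normed space over itself: limits, continuity and derivatives of maps
   R[i]^o -> R[i]^o are the complex ones. *)

Section ComplexFunctions.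
Variable R : realType.
Implicit Types (f : R -> R[i]) (z : R[i]).

Definition cis (x : R) : R[i] := cos x +i* sin x.

Definition cexp z : R[i] := (expR (complex.Re z))%:C * cis (complex.Im z).

Definition reim_derive f (x : R) : R[i] :=
  derive1 (fun y => complex.Re (f y)) x +i* derive1 (fun y => complex.Im (f y)) x.

Definition smooth f : Prop := forall (k : nat) (x : R),
  derivable (derive1n k (fun y => complex.Re (f y))) x 1 /\
  derivable (derive1n k (fun y => complex.Im (f y))) x 1.

(* The open half plane {sg * Im z > 0}; it is C_+ for sg = 1, C_- for
   sg = -1. *)
Definition half_plane (sg : R) : set R[i]^o :=
  [set z | 0 < sg * complex.Im z].

Definition closed_half_plane (sg : R) : set R[i]^o :=
  [set z | 0 <= sg * complex.Im z].

(* F is analytic in the open half plane and each of its complex derivatives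
   F = G 0, F' = G 1, F'' = G 2, ... extends continuously to the boundary. *)
Definition analytic_smooth_up_to (sg : R) (F : R[i]^o -> R[i]^o) : Prop :=
  exists G : nat -> R[i]^o -> R[i]^o,
    G 0%N = F /\
    forall k : nat,
      {within closed_half_plane sg, continuous (G k)} /\
      forall z : R[i]^o, half_plane sg z ->
        is_derive z (1 : R[i]^o) (G k) (G k.+1 z).

End ComplexFunctions.

(* Indexing: s_up 0 i is s_i^up for 0 <= i <= n; the n-tuples s^down and chi
   are indexed from 0, so for i : 'I_n (standing for the index i + 1 of the
   formulas) s_dn 0 i is s_{i+1}^down and chi 0 i is chi_{i+1}. *)
Section MultiPhase.
Variables (R : realType) (eps : R) (n : nat).
Variables (s_up : 'rV[R]_n.+1) (s_dn chi : 'rV[R]_n).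

(* sprev i is s_{i-1}^up and snext i is s_i^up in the 1-based indexing of the
   formulas. *)
Definition sprev (i : 'I_n) : R := s_up 0 (widen_ord (leqnSn n) i).
Definition snext (i : 'I_n) : R := s_up 0 (lift ord0 i).

(* s_n^up < s_n^down < s_{n-1}^up < ... < s_1^down < s_0^up *)
Definition interlaced : Prop :=
  forall i : 'I_n, snext i < s_dn 0 i /\ s_dn 0 i < sprev i.

Definition Zcoef (i : 'I_n) : R :=
  Num.sqrt ((sprev i - s_up 0 ord_max) / (s_dn 0 i - s_up 0 ord_max)) *
  \prod_(j < n | j != i)
    Num.sqrt (((s_dn 0 i - s_dn 0 j) * (sprev i - sprev j)) /
              ((sprev i - s_dn 0 j) * (s_dn 0 i - sprev j))).

Definition Mphase (x t : R) : 'M[R[i]]_n :=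
  \matrix_(i < n, j < n)
    (((sprev i - s_dn 0 j)^-1)%:C *
     (-1 + (if i == j then
              (Zcoef i)%:C *
              cis ((sprev i - s_dn 0 i) / eps *
                   (x - chi 0 i - 2^-1 * (s_dn 0 i + sprev i) * t))
            else 0))).

(* The term d/dx log det M is the logarithmic derivative (det M)' / det M. *)
Definition multi_phase (x t : R) : R :=
  s_up 0 ord_max - \sum_(i < n) (sprev i - s_dn 0 i) +
  2 * eps * complex.Im
    (reim_derive (fun y => \det (Mphase y t)) x / \det (Mphase x t)).

Definition T_up (u : R[i]) : R[i] :=
  (\prod_(i < n) (u - (s_dn 0 i)%:C)) /
  (\prod_(i < n.+1) (u - (s_up 0 i)%:C)).

Definition plane_wave (u z : R[i]) (t : R) : R[i] :=
  cexp ('i / eps%:C * (u * z - u ^+ 2 * t%:C)).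

(* Phi such that Psi(u,x) = Phi(u,x) exp ((i/eps) (u x - u^2 t)) *)
Definition periodic_part (Psi : R[i] -> R -> R -> R[i]) (u : R[i]) (x t : R) :
    R[i] :=
  Psi u x t / plane_wave u x%:C t.

(* F extends psi analytically to the half plane {sg * Im z > 0}, smoothly up to
   the boundary, and
     F(z) = (1 + O(exp(-alpha |Im z|/eps))) exp((i/eps) (u z - u^2 t))
   as sg * Im z -> +oo, uniformly in Re z. *)
Definition half_plane_extension (sg alpha : R) (u : R[i]) (t : R)
    (psi : R -> R[i]) (F : R[i]^o -> R[i]^o) : Prop :=
  [/\ forall x : R, F x%:C = psi x,
      analytic_smooth_up_to sg F &
      exists (rem : R[i] -> R[i]) (K Y : R), forall z : R[i],
        Y <= sg * complex.Im z ->
        F z = (1 + rem z) * plane_wave u z t /\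
        `|rem z| <= (K * expR (- (alpha * `|complex.Im z| / eps)))%:C].

(* Psi_p and Psi_m have the properties of the two branches Psi_+ and Psi_- of
   the Dobrokhotov-Krichever Baker-Akhiezer function of multi_phase; the
   arguments are u, x and t. The exponent alpha is uniform in u and t; the
   constant in the O may depend on them. *)
Record DK_functions (Psi_p Psi_m : R[i] -> R -> R -> R[i]) : Prop := {
  DK_smooth : forall (u : R[i]) (t : R), complex.Im u != 0 ->
    smooth (fun x => Psi_p u x t) /\ smooth (fun x => Psi_m u x t);
  DK_extension : exists2 alpha : R, 0 < alpha &
    forall (u : R[i]) (t : R), complex.Im u != 0 ->
      (exists F, half_plane_extension 1 alpha u t (fun x => Psi_p u x t) F) /\
      (exists F, half_plane_extension (-1) alpha u t (fun x => Psi_m u x t) F);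
  DK_periodic :
    (forall x t : R, multi_phase (x + 2 * pi) t = multi_phase x t) ->
    forall (u : R[i]) (x t : R), complex.Im u != 0 ->
      periodic_part Psi_p u (x + 2 * pi) t = periodic_part Psi_p u x t /\
      periodic_part Psi_m u (x + 2 * pi) t = periodic_part Psi_m u x t;
  DK_equation : forall (u : R[i]) (x t : R), complex.Im u != 0 ->
    - (- eps%:C * ('i^-1 * reim_derive (fun y => Psi_p u y t) x) +
       (multi_phase x t)%:C * Psi_p u x t) =
    (T_up u)^-1 * Psi_m u x t }.

End MultiPhase.

(* Elements of L^2(T, dx/2pi) are represented by functions on R, of which only
   the values on [0, 2pi] matter; equality in L^2 is equality almost
   everywhere on [0, 2pi]. Operators are given by their graphs. *)
Section NazarovSklyanin.
Variable R : realType.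
Implicit Types (f g p d : R -> R[i]).

Local Notation mu := (@lebesgue_measure R).

Definition circle : set R := `[0, 2 * pi].

Definition circle_mean f : R[i] :=
  ((2 * pi)^-1)%:C *
  ((\int[mu]_(x in circle) complex.Re (f x))%R +i*
   (\int[mu]_(x in circle) complex.Im (f x))%R).

Definition L2_circle f : Prop :=
  [/\ measurable_fun circle (fun y => complex.Re (f y)),
      measurable_fun circle (fun y => complex.Im (f y)) &
      (\int[mu]_(x in circle)
         (complex.Re (f x) ^+ 2 + complex.Im (f x) ^+ 2)%:E < +oo)%E].

Definition L2_eq f g : Prop := {ae mu, forall x, circle x -> f x = g x}.

(* <f|g>, antilinear in f *)
Definition bracket f g : R[i] := circle_mean (fun x => (f x)^* * g x).

Definition norm2 f : R := complex.Re (bracket f f).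

Definition ket (h : nat) : R -> R[i] := fun x => cis x ^+ h.

(* H_bullet, the closure of C[w] in L^2(T) *)
Definition Hardy f : Prop :=
  L2_circle f /\
  forall e : R, 0 < e ->
    exists P : {poly R[i]}, norm2 (fun x => f x - P.[cis x]) < e.

(* graph of the orthogonal projection pi_bullet of L^2(T) onto H_bullet *)
Definition proj_Hardy f p : Prop :=
  [/\ L2_circle f, Hardy p &
      forall k, Hardy k -> bracket k (fun x => f x - p x) = 0].

(* graph of D_bullet, the self-adjoint operator that is diagonal in the basis
   |h>; f is in its domain when sum_h h^2 |<h|f>|^2 is finite, that is when
   some d in H_bullet has the coefficients h <h|f> *)
Definition D_bullet f d : Prop :=
  [/\ Hardy f, Hardy d &
      forall h : nat, bracket (ket h) d = h%:R * bracket (ket h) f].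

Definition mult_op (v : R -> R) f : R -> R[i] := fun x => (v x)%:C * f x.

(* graph of L_bullet(v; eps) = - eps D_bullet + pi_bullet L(v) pi_bullet, on
   the domain of D_bullet; pi_bullet f = f there *)
Definition L_bullet (eps : R) (v : R -> R) f g : Prop :=
  exists d p, [/\ D_bullet f d, proj_Hardy (mult_op v f) p, Hardy g &
    L2_eq g (fun x => - eps%:C * d x + p x)].

(* A representative of (u - L_bullet(v; eps))^-1 g; the default value is taken
   only if the equation (u - L_bullet(v; eps)) f = g has no solution in the
   domain. *)
Definition resolvent (eps : R) (v : R -> R) (u : R[i]) g : R -> R[i] :=
  xget (fun=> 0) [set f | exists l, L_bullet eps v f l /\
                          L2_eq (fun x => u * f x - l x) g].

Definition BA_partial_sum (eps : R) (v : R -> R) (u w : R[i]) (N : nat) :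
    R[i]^o :=
  \sum_(h < N) bracket (ket h) (resolvent eps v u (ket 0)) * w ^+ h.

Definition Phi_BA (eps : R) (v : R -> R) (u w : R[i]) : R[i] :=
  limn (BA_partial_sum eps v u w).

End NazarovSklyanin.

(* Main.v *)
Require Import Defs.
From mathcomp Require Import measurable_realfun ring lra.

(* Multiplying the equation for Psi_+ by the inverse of the plane wave turns it
   into  u Phi_+ - (- eps D + v) Phi_+ = Phi_- / T,  D = -i d/dx.  By
   analyticity and decay in the half planes, Phi_+ has no negative Fourier
   modes and the only nonnegative mode of Phi_- is the constant 1, so projecting
   onto the Hardy space gives  (u - L) (T Phi_+) = |0>.  Symmetry of L and
   Im u != 0 make the solution unique, and the Fourier series of the smooth
   function T Phi_+ converges to it.

   The Fourier modes of Phi are computed by moving the circle to infinity in the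
   half plane, which needs Phi (z + 2 pi) = Phi z there. It is known only on the
   boundary, and extends inside because an analytic function on a half plane
   that is continuous up to the boundary and vanishes there is zero. *)

Set Implicit Arguments.
Unset Strict Implicit.
Unset Printing Implicit Defensive.

Local Open Scope classical_set_scope.
Local Open Scope ring_scope.
Local Open Scope complex_scope.

(** * Complex numbers and integrals over the circle *)

(** Complex analysis enters through real calculus. Complex differentiability is tested along real
    lines, and only first and second derivatives are carried, which is what the maximum principle
    uses. Moving the circle is differentiation under the integral sign: the vertical derivative of a
    mean is a constant times the mean of the horizontal derivative, which vanishes by periodicity.
    The extensions are only smooth up to the real line, not analytic across it, so periodicity
    inside the half plane cannot come from the identity theorem; hence the uniqueness result for
    boundary values. Elements of L^2 are represented by functions, so the resolvent equation
    determines its solution up to null sets at best. Uniqueness is therefore a statement about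
    brackets, and pointwise values come back through the Fourier series of a smooth representative.
    The product of v with the solution is not estimated directly: the equation writes it as a
    combination of smooth functions, already split into a Hardy part and a part orthogonal to the
    Hardy space. *)

Section ComplexAlgebra.
Variable R : realType.
Implicit Types (a b z : R[i]) (x y : R).

Local Notation Re := complex.Re.
Local Notation Im := complex.Im.
Local Notation "z ^*" := (Num.conj z) : complex_scope.

Lemma Re_add a b : Re (a + b) = Re a + Re b.
Proof. by case: a b => [? ?] [? ?]. Qed.
Lemma Im_add a b : Im (a + b) = Im a + Im b.
Proof. by case: a b => [? ?] [? ?]. Qed.
Lemma Re_opp a : Re (- a) = - Re a. Proof. by case: a. Qed.
Lemma Im_opp a : Im (- a) = - Im a. Proof. by case: a. Qed.
Lemma Re_mul a b : Re (a * b) = Re a * Re b - Im a * Im b.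
Proof. by case: a b => [? ?] [? ?]. Qed.
Lemma Im_mul a b : Im (a * b) = Re a * Im b + Im a * Re b.
Proof. by case: a b => [? ?] [? ?]. Qed.
Lemma Re_conj a : Re a^* = Re a. Proof. by case: a. Qed.
Lemma Im_conj a : Im a^* = - Im a. Proof. by case: a. Qed.
Lemma Re_real x : Re x%:C = x. Proof. by []. Qed.
Lemma Im_real x : Im x%:C = 0. Proof. by []. Qed.

Lemma Re_mk x y : Re (x +i* y) = x. Proof. by []. Qed.
Lemma Im_mk x y : Im (x +i* y) = y. Proof. by []. Qed.
Lemma Re_cis x : Re (cis x) = cos x. Proof. by []. Qed.
Lemma Im_cis x : Im (cis x) = sin x. Proof. by []. Qed.

Definition reimE :=
  (Re_mk, Im_mk, Re_cis, Im_cis, Re_real, Im_real,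
   Re_add, Im_add, Re_opp, Im_opp, Re_mul, Im_mul, Re_conj, Im_conj).

Lemma complex_ext a b : Re a = Re b -> Im a = Im b -> a = b.
Proof. by case: a b => [? ?] [? ?] /= -> ->. Qed.

Lemma realCM x y : (x * y)%:C = x%:C * y%:C.
Proof. by apply: complex_ext; rewrite !reimE; ring. Qed.
Lemma realCD x y : (x + y)%:C = x%:C + y%:C.
Proof. by apply: complex_ext; rewrite !reimE; ring. Qed.

(** The squared modulus as a real number: estimates stay polynomial, with neither square roots nor a
    complex valued norm. *)
Definition sqn a : R := Re a ^+ 2 + Im a ^+ 2.

Lemma sqn_ge0 a : 0 <= sqn a.
Proof. by rewrite addr_ge0 ?sqr_ge0. Qed.

Lemma sqnM a b : sqn (a * b) = sqn a * sqn b.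
Proof. by rewrite /sqn !reimE; ring. Qed.

Lemma sqn_eq0 a : sqn a = 0 -> a = 0.
Proof.
move=> h; have : Re a ^+ 2 + Im a ^+ 2 == 0 by rewrite -/(sqn a) h.
rewrite paddr_eq0 ?sqr_ge0// !sqrf_eq0 => /andP[/eqP h1 /eqP h2].
exact: complex_ext.
Qed.

Lemma conj_mul_self a : a^* * a = (sqn a)%:C.
Proof. by apply: complex_ext; rewrite /sqn !reimE; ring. Qed.

Lemma cis0 : cis (0 : R) = 1.
Proof. by rewrite /cis cos0 sin0. Qed.
Lemma cisD x y : cis (x + y) = cis x * cis y.
Proof. by apply: complex_ext; rewrite !reimE /= ?cosD ?sinD; ring. Qed.
Lemma cisN x : cis (- x) = (cis x)^*.
Proof. by rewrite /cis cosN sinN. Qed.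
Lemma sqn_cis x : sqn (cis x) = 1.
Proof. by rewrite /sqn /= cos2Dsin2. Qed.
Lemma cisX x (n : nat) : cis x ^+ n = cis (n%:R * x).
Proof.
elim: n => [|n IH]; first by rewrite expr0 mul0r cis0.
by rewrite exprS IH -cisD -natr1 mulrDl mul1r addrC.
Qed.
Lemma cis_2pi : cis (2 * pi : R) = 1.
Proof. by rewrite /cis mulr_natl cos2pi sin2pi. Qed.

Lemma cexpD a b : cexp (a + b) = cexp a * cexp b.
Proof.
by rewrite /cexp !reimE expRD cisD (rmorphM (real_complex R)) mulrACA.
Qed.
Lemma cexp0 : cexp (0 : R[i]) = 1.
Proof. by rewrite /cexp /= expR0 cis0 mulr1. Qed.
Lemma cexpV a : cexp (- a) * cexp a = 1.
Proof. by rewrite -cexpD addNr cexp0. Qed.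
Lemma cexp_neq0 a : cexp a != 0.
Proof.
apply/eqP => h; have := cexpV a; rewrite h mulr0 => /esym/eqP.
by rewrite oner_eq0.
Qed.
Lemma cexpN a : cexp (- a) = (cexp a)^-1.
Proof. by apply: (mulIf (cexp_neq0 a)); rewrite cexpV mulVf// cexp_neq0. Qed.
Lemma cexp_i x : cexp ('i * x%:C) = cis x.
Proof.
by rewrite /cexp !reimE/= mul0r mulr0 subrr expR0 mulr0 mul1r add0r mul1r.
Qed.

End ComplexAlgebra.

(** * Means and square integrable functions on the circle *)

Section CircleIntegral.
Variable R : realType.
Implicit Types (f g : R -> R[i]) (c : R[i]).

Local Notation Re := complex.Re.
Local Notation Im := complex.Im.
Local Notation "z ^*" := (Num.conj z) : complex_scope.
Local Notation mu := (@lebesgue_measure R).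
Local Notation circle := (@circle R).

Definition cintegrable f : Prop :=
  mu.-integrable circle (EFin \o (fun x => Re (f x))) /\
  mu.-integrable circle (EFin \o (fun x => Im (f x))).

Lemma measurable_circle : measurable (circle : set (measurableTypeR R)).
Proof. exact: measurable_itv. Qed.
#[local] Hint Resolve measurable_circle : core.

Lemma intR_ext (u v : R -> R) : u =1 v ->
  mu.-integrable circle (EFin \o u) -> mu.-integrable circle (EFin \o v).
Proof. by move=> /funext ->. Qed.

Lemma intRD (u v : R -> R) : mu.-integrable circle (EFin \o u) ->
  mu.-integrable circle (EFin \o v) ->
  mu.-integrable circle (EFin \o (fun x => u x + v x)).
Proof. by move=> hu hv; have := integrableD measurable_circle hu hv. Qed.

Lemma intRZ k (u : R -> R) : mu.-integrable circle (EFin \o u) ->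
  mu.-integrable circle (EFin \o (fun x => k * u x)).
Proof. by move=> hu; have := integrableZl measurable_circle k hu. Qed.

Lemma cintegrableD f g : cintegrable f -> cintegrable g ->
  cintegrable (fun x => f x + g x).
Proof.
move=> [f1 f2] [g1 g2]; split.
  by apply: intR_ext (intRD f1 g1) => x; rewrite reimE.
by apply: intR_ext (intRD f2 g2) => x; rewrite reimE.
Qed.

Lemma cintegrableZ c f : cintegrable f -> cintegrable (fun x => c * f x).
Proof.
move=> [f1 f2]; split.
  apply: intR_ext (intRD (intRZ (Re c) f1) (intRZ (- Im c) f2)) => x.
  by rewrite reimE; ring.
apply: intR_ext (intRD (intRZ (Re c) f2) (intRZ (Im c) f1)) => x.
by rewrite reimE; ring.
Qed.

Lemma cintegrable_conj f : cintegrable f -> cintegrable (fun x => (f x)^*).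
Proof.
move=> [f1 f2]; split; first by apply: intR_ext f1 => x; rewrite reimE.
by apply: intR_ext (intRZ (-1) f2) => x; rewrite reimE mulN1r.
Qed.

Lemma circle_mean_ext f g : (forall x, circle x -> f x = g x) ->
  circle_mean f = circle_mean g.
Proof.
move=> h; rewrite /circle_mean; congr (_ * (_ +i* _));
  by apply: eq_Rintegral => x /set_mem/h ->.
Qed.

Lemma circle_meanD f g : cintegrable f -> cintegrable g ->
  circle_mean (fun x => f x + g x) = circle_mean f + circle_mean g.
Proof.
move=> [f1 f2] [g1 g2]; rewrite /circle_mean -mulrDr; congr (_ * _).
rewrite -[RHS]/((_ + _) +i* (_ + _)); congr (_ +i* _); rewrite -RintegralD//;
  by apply: eq_Rintegral => x _; rewrite reimE.
Qed.

Lemma circle_meanZ c f : cintegrable f ->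
  circle_mean (fun x => c * f x) = c * circle_mean f.
Proof.
move=> [f1 f2]; rewrite /circle_mean mulrCA; congr (_ * _).
apply: complex_ext; rewrite !reimE /=.
  transitivity (\int[mu]_(x in circle) (Re c * Re (f x) + (- Im c) * Im (f x))).
    by apply: eq_Rintegral => x _; rewrite reimE; ring.
  by rewrite RintegralD ?RintegralZl//; [rewrite mulNr|exact: intRZ..].
transitivity (\int[mu]_(x in circle) (Re c * Im (f x) + Im c * Re (f x))).
  by apply: eq_Rintegral => x _; rewrite reimE; ring.
by rewrite RintegralD ?RintegralZl//; exact: intRZ.
Qed.

Lemma circle_mean_conj f : cintegrable f ->
  circle_mean (fun x => (f x)^*) = (circle_mean f)^*.
Proof.
move=> [f1 f2]; rewrite /circle_mean; apply: complex_ext; rewrite !reimE/=;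
  rewrite ?mul0r ?addr0 ?subr0.
  by congr (_ * _); apply: eq_Rintegral => x _; rewrite reimE.
rewrite -mulrN; congr (_ * _).
rewrite -mulN1r -RintegralZl//.
by apply: eq_Rintegral => x _; rewrite reimE mulN1r.
Qed.

Lemma circle_mean_ge0 f : (forall x, 0 <= Re (f x)) -> 0 <= Re (circle_mean f).
Proof.
move=> h; rewrite !reimE mul0r subr0 /= mulr_ge0 ?invr_ge0 ?mulr_ge0 ?pi_ge0//.
exact: Rintegral_ge0.
Qed.

Lemma circle_mean_real f : (forall x, Im (f x) = 0) -> Im (circle_mean f) = 0.
Proof.
move=> h; rewrite !reimE mul0r addr0 /=.
under eq_Rintegral do rewrite h.
by rewrite Rintegral_cst// mul0r mulr0.
Qed.

Lemma fine_mu_circle : fine (mu circle) = 2 * pi.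
Proof. by rewrite lebesgue_measure_itv/= lte_fin mulr_gt0 ?pi_gt0//= subr0. Qed.

Lemma circle_mean_cst c : circle_mean (fun=> c) = c.
Proof.
have p0 : 2 * pi != 0 :> R by rewrite mulf_neq0// gt_eqF// pi_gt0.
rewrite /circle_mean !Rintegral_cst// !fine_mu_circle.
by apply: complex_ext; rewrite !reimE/= mul0r ?subr0 ?addr0 mulrC mulfK.
Qed.

Lemma continuous_intR (u : R -> R) : continuous u ->
  mu.-integrable circle (EFin \o u).
Proof.
move=> cu; apply: continuous_compact_integrable; first exact: segment_compact.
exact: continuous_subspaceT.
Qed.

Lemma cintegrable_cst c : cintegrable (fun=> c).
Proof. by split; apply: continuous_intR => x; exact: cvg_cst. Qed.

Lemma circle_mean_bound f B : cintegrable f ->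
  (forall x, circle x -> sqn (f x) <= B ^+ 2) -> 0 <= B ->
  `|Re (circle_mean f)| <= B /\ `|Im (circle_mean f)| <= B.
Proof.
move=> [f1 f2] h B0.
have key (u : R -> R) : mu.-integrable circle (EFin \o u) ->
    (forall x, circle x -> `|u x| <= B) ->
    `|(2 * pi)^-1 * \int[mu]_(x in circle) u x| <= B.
  move=> iu hu; have p0 : 0 < 2 * pi :> R by rewrite mulr_gt0// pi_gt0.
  rewrite normrM gtr0_norm ?invr_gt0// mulrC ler_pdivrMr//.
  apply: (le_trans (le_normr_Rintegral measurable_circle iu)).
  have -> : B * (2 * pi) = \int[mu]_(x in circle) B.
    by rewrite Rintegral_cst// fine_mu_circle.
  apply: le_Rintegral => //.
    by have := integrable_norm iu.
  by have [] := cintegrable_cst B%:C.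
have sq x : circle x -> `|Re (f x)| <= B /\ `|Im (f x)| <= B.
  move=> cx; have := h x cx; rewrite /sqn => hh.
  split; rewrite -ler_sqr ?nnegrE// ?normr_ge0// real_normK ?num_real//;
    by apply: le_trans hh; rewrite ?lerDl ?lerDr sqr_ge0.
rewrite !reimE !mul0r subr0 addr0 /=.
by split; apply: key => // x /sq[].
Qed.

Lemma L2_circleP f : L2_circle f <->
  [/\ measurable_fun circle (fun x => Re (f x) : measurableTypeR R),
      measurable_fun circle (fun x => Im (f x) : measurableTypeR R) &
      mu.-integrable circle (EFin \o (fun x => sqn (f x)))].
Proof.
have mf : measurable_fun circle (fun x => Re (f x) : measurableTypeR R) ->
    measurable_fun circle (fun x => Im (f x) : measurableTypeR R) ->
    measurable_fun circle (EFin \o (fun x => sqn (f x))).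
  move=> m1 m2; apply/measurable_EFinP.
  by apply: measurable_funD; apply: measurable_funX.
split=> -[m1 m2 h]; split=> //.
  apply/integrableP; split; first exact: mf.
  rewrite (le_lt_trans _ h)// le_eqVlt; apply/orP; left; apply/eqP.
  by apply: eq_integral => x _ /=; rewrite ger0_norm// sqn_ge0.
move/integrableP: h => [_]; apply: le_lt_trans; rewrite le_eqVlt.
apply/orP; left; apply/eqP; apply: eq_integral => x _ /=.
by rewrite ger0_norm// sqn_ge0.
Qed.

(** A crude bound: with it the sum of two squared moduli dominates the real and imaginary parts of a
    product, which makes that product integrable. *)
Lemma ler_norm_dot (a b c d : R) :
  `|a * b + c * d| <= a ^+ 2 + c ^+ 2 + (b ^+ 2 + d ^+ 2).
Proof.
have h1 := sqr_ge0 (a + b); have h2 := sqr_ge0 (a - b).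
have h3 := sqr_ge0 (c + d); have h4 := sqr_ge0 (c - d).
have := sqr_ge0 a; have := sqr_ge0 b; have := sqr_ge0 c; have := sqr_ge0 d.
by rewrite ler_norml => *; apply/andP; split; nra.
Qed.

Lemma dominated_intR (u v : R -> R) :
  measurable_fun circle (u : R -> measurableTypeR R) ->
  (forall x, circle x -> `|u x| <= v x) ->
  mu.-integrable circle (EFin \o v) -> mu.-integrable circle (EFin \o u).
Proof.
move=> mu_ uv iv; apply: (le_integrable measurable_circle _ _ iv).
  exact/measurable_EFinP.
by move=> x cx /=; rewrite lee_fin (le_trans (uv x cx))// ler_norm.
Qed.

Lemma L2_cintegrable_mul f g : L2_circle f -> L2_circle g ->
  cintegrable (fun x => (f x)^* * g x).
Proof.
move=> /L2_circleP[f1 f2 f3] /L2_circleP[g1 g2 g3].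
have dom := intRD f3 g3; split.
  apply: dominated_intR dom => [|x _].
    rewrite (_ : (fun x => _) =
      (fun x => Re (f x) * Re (g x) + Im (f x) * Im (g x))); last first.
      by apply/funext => x; rewrite !reimE; ring.
    by apply: measurable_funD; apply: measurable_funM.
  by rewrite !reimE mulNr opprK ler_norm_dot.
apply: dominated_intR dom => [|x _].
  rewrite (_ : (fun x => _) =
    (fun x => Re (f x) * Im (g x) - Im (f x) * Re (g x))); last first.
    by apply/funext => x; rewrite !reimE; ring.
  by apply: measurable_funB; apply: measurable_funM.
rewrite !reimE (le_trans (ler_norm_dot _ _ _ _))// /sqn sqrrN.
by rewrite [X in _ + _ + X <= _]addrC.
Qed.

Lemma L2_circleD f g : L2_circle f -> L2_circle g ->
  L2_circle (fun x => f x + g x).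
Proof.
move=> /L2_circleP[f1 f2 f3] /L2_circleP[g1 g2 g3]; apply/L2_circleP.
have m1 : measurable_fun circle (fun x => Re (f x + g x) : measurableTypeR R).
  rewrite (_ : (fun x => _) = (fun x => Re (f x) + Re (g x))); last first.
    by apply/funext => x; rewrite reimE.
  exact: measurable_funD.
have m2 : measurable_fun circle (fun x => Im (f x + g x) : measurableTypeR R).
  rewrite (_ : (fun x => _) = (fun x => Im (f x) + Im (g x))); last first.
    by apply/funext => x; rewrite reimE.
  exact: measurable_funD.
split => //.
apply: dominated_intR (intRZ 2 (intRD f3 g3)) => [|x _].
  by apply: measurable_funD; apply: measurable_funX.
rewrite ger0_norm ?sqn_ge0// /sqn !reimE.
have := sqr_ge0 (Re (f x) - Re (g x)); have := sqr_ge0 (Im (f x) - Im (g x)).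
nra.
Qed.

Lemma L2_circleZ c f : L2_circle f -> L2_circle (fun x => c * f x).
Proof.
move=> /L2_circleP[f1 f2 f3]; apply/L2_circleP; split.
- rewrite (_ : (fun x => _) = (fun x => Re c * Re (f x) - Im c * Im (f x))).
    by apply: measurable_funB; apply: measurable_funM.
  by apply/funext => x; rewrite reimE.
- rewrite (_ : (fun x => _) = (fun x => Re c * Im (f x) + Im c * Re (f x))).
    by apply: measurable_funD; apply: measurable_funM.
  by apply/funext => x; rewrite reimE.
- by apply: intR_ext (intRZ (sqn c) f3) => x; rewrite sqnM.
Qed.

Lemma bounded_L2_circle f B :
  measurable_fun circle (fun x => Re (f x) : measurableTypeR R) ->
  measurable_fun circle (fun x => Im (f x) : measurableTypeR R) ->
  (forall x, circle x -> sqn (f x) <= B) -> L2_circle f.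
Proof.
move=> m1 m2 h; apply/L2_circleP; split => //.
have [iB _] := cintegrable_cst B%:C.
apply: dominated_intR iB => [|x cx].
  by apply: measurable_funD; apply: measurable_funX.
by rewrite ger0_norm ?sqn_ge0// h.
Qed.

Lemma L2_circle_cst c : L2_circle (fun=> c).
Proof. by apply: (@bounded_L2_circle _ (sqn c)). Qed.

End CircleIntegral.

(** * The inner product, Cauchy-Schwarz and Bessel inequalities *)

Section InnerProduct.
Variable R : realType.
Implicit Types (f g k : R -> R[i]) (c : R[i]).

Local Notation Re := complex.Re.
Local Notation Im := complex.Im.
Local Notation "z ^*" := (Num.conj z) : complex_scope.
Local Notation mu := (@lebesgue_measure R).
Local Notation circle := (@circle R).

Lemma L2_circleB f g : L2_circle f -> L2_circle g ->
  L2_circle (fun x => f x - g x).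
Proof.
move=> hf hg; have := L2_circleD hf (L2_circleZ (-1) hg).
by under eq_fun do rewrite mulN1r.
Qed.

Lemma L2_circle_sum (e : nat -> R -> R[i]) (a : nat -> R[i]) N :
  (forall h, L2_circle (e h)) ->
  L2_circle (fun x => \sum_(h < N) a h * e h x).
Proof.
move=> he; elim: N => [|N IH].
  by under eq_fun do rewrite big_ord0; exact: L2_circle_cst.
under eq_fun do rewrite big_ord_recr /=.
by apply: L2_circleD => //; apply: L2_circleZ.
Qed.

Lemma bracketDr f g k : L2_circle f -> L2_circle g -> L2_circle k ->
  bracket k (fun x => f x + g x) = bracket k f + bracket k g.
Proof.
move=> hf hg hk; rewrite /bracket -circle_meanD;
  [|exact: L2_cintegrable_mul..].
by apply: circle_mean_ext => x _; rewrite mulrDr.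
Qed.

Lemma bracketZr f k c : L2_circle f -> L2_circle k ->
  bracket k (fun x => c * f x) = c * bracket k f.
Proof.
move=> hf hk; rewrite /bracket -circle_meanZ; last exact: L2_cintegrable_mul.
by apply: circle_mean_ext => x _; rewrite mulrCA.
Qed.

Lemma bracketBr f g k : L2_circle f -> L2_circle g -> L2_circle k ->
  bracket k (fun x => f x - g x) = bracket k f - bracket k g.
Proof.
move=> hf hg hk; rewrite -[- bracket k g]mulN1r -bracketZr// -bracketDr//.
  by apply: circle_mean_ext => x _; rewrite mulN1r.
exact: L2_circleZ.
Qed.

Lemma bracketC f g : L2_circle f -> L2_circle g ->
  bracket f g = (bracket g f)^*.
Proof.
move=> hf hg; rewrite /bracket -circle_mean_conj; last exact: L2_cintegrable_mul.
by apply: circle_mean_ext => x _; apply: complex_ext; rewrite !reimE; ring.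
Qed.

Lemma bracketBl f g k : L2_circle f -> L2_circle g -> L2_circle k ->
  bracket (fun x => f x - g x) k = bracket f k - bracket g k.
Proof.
move=> hf hg hk; rewrite bracketC//; last exact: L2_circleB.
by rewrite bracketBr// rmorphB/= -!bracketC.
Qed.

Lemma bracketZl f k c : L2_circle f -> L2_circle k ->
  bracket (fun x => c * f x) k = c^* * bracket f k.
Proof.
move=> hf hk; rewrite bracketC//; last exact: L2_circleZ.
by rewrite bracketZr// rmorphM/= -bracketC.
Qed.

Lemma bracket_sumr (e : nat -> R -> R[i]) (a : nat -> R[i]) N k :
  (forall h, L2_circle (e h)) -> L2_circle k ->
  bracket k (fun x => \sum_(h < N) a h * e h x) =
  \sum_(h < N) a h * bracket k (e h).
Proof.
move=> he hk; elim: N => [|N IH].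
  rewrite big_ord0; transitivity (0 * bracket k (fun=> 0)); last exact: mul0r.
  rewrite -bracketZr//; last exact: L2_circle_cst.
  by apply: circle_mean_ext => x _; rewrite big_ord0 mul0r.
rewrite big_ord_recr /= -IH -bracketZr// -bracketDr//.
- by apply: circle_mean_ext => x _; rewrite big_ord_recr.
- exact: L2_circle_sum.
- exact: L2_circleZ.
Qed.

Lemma bracket_suml (e : nat -> R -> R[i]) (a : nat -> R[i]) N k :
  (forall h, L2_circle (e h)) -> L2_circle k ->
  bracket (fun x => \sum_(h < N) a h * e h x) k =
  \sum_(h < N) (a h)^* * bracket (e h) k.
Proof.
move=> he hk; rewrite bracketC//; last exact: L2_circle_sum.
rewrite bracket_sumr// rmorph_sum/=; apply: eq_bigr => h _.
by rewrite rmorphM/= -bracketC.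
Qed.

Lemma bracket_self f : bracket f f = (norm2 f)%:C.
Proof.
apply: complex_ext => //; rewrite Im_real; apply: circle_mean_real => x.
by rewrite conj_mul_self.
Qed.

Lemma norm2_ge0 f : 0 <= norm2 f.
Proof. by apply: circle_mean_ge0 => x; rewrite conj_mul_self sqn_ge0. Qed.

Lemma norm2_sub f g c : L2_circle f -> L2_circle g ->
  norm2 (fun x => g x - c * f x) =
  norm2 g - 2 * Re (c^* * bracket f g) + sqn c * norm2 f.
Proof.
move=> hf hg; have hcf := L2_circleZ c hf.
rewrite {1}/norm2 bracketBr ?bracketBl//; last exact: L2_circleB.
rewrite !bracketZr// !bracketZl// !bracket_self (bracketC hg hf).
move: (bracket f g) (norm2 f) (norm2 g) => b p q.
by rewrite !reimE /sqn; ring.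
Qed.

Lemma cauchy_schwarz f g : L2_circle f -> L2_circle g ->
  sqn (bracket f g) <= norm2 f * norm2 g.
Proof.
move=> hf hg; set b := bracket f g.
(* Subtracting the multiple t b of f, with b the bracket itself, makes the cross term real, so a
   real parameter t suffices. *)
have key (t : R) : 0 <= norm2 g - 2 * t * sqn b + t ^+ 2 * sqn b * norm2 f.
  have := norm2_ge0 (fun x => g x - t%:C * b * f x).
  rewrite norm2_sub// sqnM -/b; move: b (norm2 f) (norm2 g) => b p q.
  rewrite !reimE /sqn !reimE => h; apply: (le_trans h).
  by rewrite le_eqVlt; apply/orP; left; apply/eqP; ring.
(* A vanishing norm makes f zero only almost everywhere. Then [key] is affine in t, and a large t
   contradicts it unless b = 0; otherwise the minimizer t = 1 / [norm2 f] gives the claim. *)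
have [f0|f0] := eqVneq (norm2 f) 0.
  rewrite f0 mul0r leNgt; apply/negP => b0.
  have := key (norm2 g / sqn b); rewrite f0 mulr0 addr0 -mulrA divfK ?gt_eqF//.
  have g0 := norm2_ge0 g.
  have := key ((norm2 g + 1) / sqn b).
  by rewrite f0 mulr0 addr0 -mulrA divfK ?gt_eqF// => *; lra.
have fp : 0 < norm2 f by rewrite lt_neqAle eq_sym f0 norm2_ge0.
have := key (norm2 f)^-1.
rewrite (_ : _ - _ + _ = norm2 g - sqn b / norm2 f); last by field.
by rewrite subr_ge0 ler_pdivrMr// mulrC.
Qed.

Definition orthonormal (e : nat -> R -> R[i]) : Prop :=
  (forall h, L2_circle (e h)) /\
  forall h l, bracket (e h) (e l) = (h == l)%:R.

(** Completing the square one term at a time. The coefficients a enter only through the last sum,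
    which vanishes for the Fourier coefficients; Bessel's inequality and best approximation both
    follow. *)
Lemma norm2_sub_sum (e : nat -> R -> R[i]) (a : nat -> R[i]) N f :
  orthonormal e -> L2_circle f ->
  norm2 (fun x => f x - \sum_(h < N) a h * e h x) =
  norm2 f - \sum_(h < N) sqn (bracket (e h) f) +
  \sum_(h < N) sqn (a h - bracket (e h) f).
Proof.
move=> [he oe] hf; elim: N => [|N IH].
  rewrite !big_ord0 subr0 addr0; congr Re; apply: circle_mean_ext => x _.
  by rewrite big_ord0 subr0.
rewrite !big_ord_recr/=; set S := fun x => \sum_(h < N) a h * e h x.
have hS : L2_circle S by exact: L2_circle_sum.
transitivity (norm2 (fun x => (f x - S x) - a N * e N x)).
  congr Re; apply: circle_mean_ext => x _.
  by rewrite big_ord_recr/= opprD addrA.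
rewrite norm2_sub//; last exact: L2_circleB.
have -> : bracket (e N) (fun x => f x - S x) = bracket (e N) f.
  rewrite bracketBr// bracket_sumr// big1 ?subr0// => h _.
  by rewrite oe gtn_eqF// mulr0.
rewrite IH.
have -> : norm2 (e N) = 1 by rewrite /norm2 oe eqxx.
move: (bracket (e N) f) (a N) => b c; rewrite /sqn !reimE; ring.
Qed.

Lemma bessel (e : nat -> R -> R[i]) N f : orthonormal e -> L2_circle f ->
  \sum_(h < N) sqn (bracket (e h) f) <= norm2 f.
Proof.
move=> oe hf; rewrite -subr_ge0.
have := norm2_ge0 (fun x => f x - \sum_(h < N) bracket (e h) f * e h x).
rewrite (norm2_sub_sum (fun h => bracket (e h) f))//.
by rewrite [X in _ + X]big1 ?addr0// => h _; rewrite subrr /sqn expr0n addr0.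
Qed.

Lemma best_approximation (e : nat -> R -> R[i]) (a : nat -> R[i]) N f :
  orthonormal e -> L2_circle f ->
  norm2 (fun x => f x - \sum_(h < N) bracket (e h) f * e h x) <=
  norm2 (fun x => f x - \sum_(h < N) a h * e h x).
Proof.
move=> oe hf; rewrite (norm2_sub_sum a)//.
rewrite (norm2_sub_sum (fun h => bracket (e h) f))// lerD2l big1; last first.
  by move=> h _; rewrite subrr /sqn expr0n addr0.
by apply: sumr_ge0 => h _; exact: sqn_ge0.
Qed.

Lemma bracket_L2_eq f g k : L2_circle f -> L2_circle g -> L2_circle k ->
  L2_eq f g -> bracket k f = bracket k g.
Proof.
move=> hf hg hk fg.
have [f1 f2] := L2_cintegrable_mul hk hf.
have [g1 g2] := L2_cintegrable_mul hk hg.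
rewrite /bracket /circle_mean; congr (_ * (_ +i* _)); rewrite /Rintegral;
  congr fine; apply: ae_eq_integral; try exact: measurable_circle.
- by case/integrableP : f1.
- by case/integrableP : g1.
- apply: (@filterS _ _ (ae_filter_ringOfSetsType mu) _ _ _ fg) => x h cx /=.
  by rewrite h.
- by case/integrableP : f2.
- by case/integrableP : g2.
- apply: (@filterS _ _ (ae_filter_ringOfSetsType mu) _ _ _ fg) => x h cx /=.
  by rewrite h.
Qed.

End InnerProduct.

(** * Derivatives of complex valued functions of a real variable *)

Section ComplexDerivative.
Variable R : realType.
Implicit Types (f g : R -> R[i]) (c : R[i]) (x : R).

Local Notation Re := complex.Re.
Local Notation Im := complex.Im.
Local Notation "z ^*" := (Num.conj z) : complex_scope.
Local Notation mu := (@lebesgue_measure R).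
Local Notation circle := (@circle R).

Definition cderiv f x c : Prop :=
  is_derive x (1 : R) (fun y => Re (f y)) (Re c) /\
  is_derive x (1 : R) (fun y => Im (f y)) (Im c).

Definition ccontinuous f : Prop :=
  continuous (fun y => Re (f y)) /\ continuous (fun y => Im (f y)).

Lemma cderiv_ext f g x c : f =1 g -> cderiv f x c -> cderiv g x c.
Proof. by move=> /funext ->. Qed.

Lemma cderiv_unique f x c c' : cderiv f x c -> cderiv f x c' -> c = c'.
Proof.
move=> [a1 a2] [b1 b2]; apply: complex_ext.
  by rewrite -(@derive_val _ _ _ _ _ _ _ a1) (@derive_val _ _ _ _ _ _ _ b1).
by rewrite -(@derive_val _ _ _ _ _ _ _ a2) (@derive_val _ _ _ _ _ _ _ b2).
Qed.

Lemma cderiv_cst c x : cderiv (fun=> c) x 0.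
Proof. by split; exact: is_derive_cst. Qed.

Lemma cderivD f g x a b : cderiv f x a -> cderiv g x b ->
  cderiv (fun y => f y + g y) x (a + b).
Proof.
move=> [f1 f2] [g1 g2]; split; rewrite reimE.
  by under eq_fun do rewrite reimE; exact: is_deriveD.
by under eq_fun do rewrite reimE; exact: is_deriveD.
Qed.

Lemma cderivM f g x a b : cderiv f x a -> cderiv g x b ->
  cderiv (fun y => f y * g y) x (a * g x + f x * b).
Proof.
move=> [f1 f2] [g1 g2]; split.
  under eq_fun do rewrite reimE.
  have h := is_deriveB (is_deriveM f1 g1) (is_deriveM f2 g2).
  apply: is_derive_eq h _; rewrite !reimE /GRing.scale/=; ring.
under eq_fun do rewrite reimE.
have h := is_deriveD (is_deriveM f1 g2) (is_deriveM f2 g1).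
apply: is_derive_eq h _; rewrite !reimE /GRing.scale/=; ring.
Qed.

Lemma cderivZ c f x a : cderiv f x a -> cderiv (fun y => c * f y) x (c * a).
Proof.
move=> hf; have := cderivM (cderiv_cst c x) hf.
by rewrite mul0r add0r.
Qed.

Lemma cderiv_cexp (a b : R[i]) x :
  cderiv (fun y => cexp (a * y%:C + b)) x (a * cexp (a * x%:C + b)).
Proof.
have e y : cexp (a * y%:C + b) =
  (expR (Re a * y + Re b))%:C * cis (Im a * y + Im b).
  by rewrite /cexp !reimE !mulr0 subr0 add0r.
have d1 (p q : R) : is_derive x (1 : R) (fun y : R => p * y + q) p.
  have h := is_deriveD (is_deriveZ p (is_derive_id x (1 : R)))
    (is_derive_cst q x 1).
  by apply: is_derive_eq h _; rewrite /GRing.scale/= mulr1 addr0.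
have dE : is_derive x (1 : R) (fun y => expR (Re a * y + Re b))
    (expR (Re a * x + Re b) * Re a).
  exact: (is_derive1_comp (is_derive_expR _) (d1 _ _)).
have dC : is_derive x (1 : R) (fun y => cos (Im a * y + Im b))
    (- (sin (Im a * x + Im b) * Im a)).
  rewrite -mulNr; exact: (is_derive1_comp (is_derive_cos _) (d1 _ _)).
have dS : is_derive x (1 : R) (fun y => sin (Im a * y + Im b))
    (cos (Im a * x + Im b) * Im a).
  exact: (is_derive1_comp (is_derive_sin _) (d1 _ _)).
apply: (@cderiv_ext (fun y => (expR (Re a * y + Re b))%:C *
   cis (Im a * y + Im b))) => [y|]; first by rewrite e.
rewrite e.
rewrite (_ : a * _ = (expR (Re a * x + Re b) * Re a)%:C *
    cis (Im a * x + Im b) + (expR (Re a * x + Re b))%:C *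
    (- (sin (Im a * x + Im b) * Im a) +i* (cos (Im a * x + Im b) * Im a))).
  by apply: cderivM; split; rewrite ?reimE => //; exact: is_derive_cst.
by apply: complex_ext; rewrite !reimE; ring.
Qed.

Lemma cderiv_cis (m : R) x :
  cderiv (fun y => cis (m * y)) x ('i * m%:C * cis (m * x)).
Proof.
have e y : cexp ('i * m%:C * y%:C + 0) = cis (m * y).
  by rewrite addr0 -mulrA -realCM cexp_i.
by have := cderiv_cexp ('i * m%:C) 0 x; rewrite e; apply: cderiv_ext.
Qed.

Lemma cderiv_continuous f (f' : R -> R[i]) :
  (forall x, cderiv f x (f' x)) -> ccontinuous f.
Proof.
move=> h; split => x; apply: differentiable_continuous; apply/derivable1_diffP.
  by have [[]] := h x.
by have [_ []] := h x.
Qed.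

Lemma ccontinuousD f g : ccontinuous f -> ccontinuous g ->
  ccontinuous (fun x => f x + g x).
Proof.
move=> [f1 f2] [g1 g2]; split => x.
  rewrite (_ : (fun y => _) = (fun y => Re (f y) + Re (g y))).
    by apply: cvgD; [exact: f1|exact: g1].
  by apply/funext => y; rewrite reimE.
rewrite (_ : (fun y => _) = (fun y => Im (f y) + Im (g y))).
  by apply: cvgD; [exact: f2|exact: g2].
by apply/funext => y; rewrite reimE.
Qed.

Lemma ccontinuousM f g : ccontinuous f -> ccontinuous g ->
  ccontinuous (fun x => f x * g x).
Proof.
move=> [f1 f2] [g1 g2]; split => x.
  rewrite (_ : (fun y => _) =
    (fun y => Re (f y) * Re (g y) - Im (f y) * Im (g y))).
    by apply: cvgB; apply: cvgM; [exact: f1|exact: g1|exact: f2|exact: g2].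
  by apply/funext => y; rewrite reimE.
rewrite (_ : (fun y => _) =
  (fun y => Re (f y) * Im (g y) + Im (f y) * Re (g y))).
  by apply: cvgD; apply: cvgM; [exact: f1|exact: g2|exact: f2|exact: g1].
by apply/funext => y; rewrite reimE.
Qed.

Lemma ccontinuous_cst c : ccontinuous (fun=> c).
Proof. by split => x; exact: cvg_cst. Qed.

Lemma ccontinuous_bounded f a b : ccontinuous f ->
  exists2 B, 0 <= B & forall x, a <= x <= b -> sqn (f x) <= B.
Proof.
move=> [f1 f2]; have [ab|ba] := leP a b; last first.
  exists 0 => // x /andP[ax xb].
  by have := lt_le_trans ba (le_trans ax xb); rewrite ltxx.
have cs : continuous (fun x => sqn (f x)).
  move=> x; apply: cvgD; rewrite expr2; under eq_fun do rewrite expr2.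
    by apply: cvgM; exact: f1.
  by apply: cvgM; exact: f2.
have [c _ hc] := EVT_max ab (continuous_subspaceT cs).
exists (sqn (f c)); first exact: sqn_ge0.
by move=> x hx; apply: hc; rewrite in_itv.
Qed.

Lemma ccontinuous_cintegrable f : ccontinuous f -> cintegrable f.
Proof. by move=> [f1 f2]; split; exact: continuous_intR. Qed.

Lemma ccontinuous_L2 f : ccontinuous f -> L2_circle f.
Proof.
move=> cf; have [B B0 hB] := ccontinuous_bounded 0 (2 * pi) cf.
have [f1 f2] := cf.
apply: (@bounded_L2_circle _ _ B).
- by apply: measurable_funTS; exact: continuous_measurable_fun.
- by apply: measurable_funTS; exact: continuous_measurable_fun.
- by move=> x; rewrite /Defs.circle /= in_itv => /hB.
Qed.

Lemma continuous_FTC (F f : R -> R) (a b : R) : a < b ->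
  (forall x, is_derive x (1 : R) F (f x)) -> continuous f ->
  \int[mu]_(x in `[a, b]) f x = F b - F a.
Proof.
move=> ab dF cf.
have cF : continuous F.
  move=> x; apply: differentiable_continuous; apply/derivable1_diffP.
  exact: (@ex_derive _ _ _ _ _ _ _ (dF x)).
rewrite /Rintegral (@continuous_FTC2 _ f F a b ab) //.
- exact: continuous_subspaceT.
- split.
  + by move=> x _; exact: (@ex_derive _ _ _ _ _ _ _ (dF x)).
  + by apply: cvg_at_right_filter; exact: cF.
  + by apply: cvg_at_left_filter; exact: cF.
- by move=> x _; rewrite derive1E (@derive_val _ _ _ _ _ _ _ (dF x)).
Qed.

Lemma circle_mean_deriv f (f' : R -> R[i]) :
  (forall x, cderiv f x (f' x)) -> ccontinuous f' ->
  circle_mean f' = ((2 * pi)^-1)%:C * (f (2 * pi) - f 0).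
Proof.
move=> df [c1 c2]; rewrite /circle_mean; congr (_ * _).
have p0 : 0 < 2 * pi :> R by rewrite mulr_gt0// pi_gt0.
have -> : \int[mu]_(x in circle) Re (f' x) = Re (f (2 * pi)) - Re (f 0).
  by apply: (@continuous_FTC (fun x => Re (f x)) (fun x => Re (f' x)) _ _ p0 _
    c1) => x; have [] := df x.
have -> : \int[mu]_(x in circle) Im (f' x) = Im (f (2 * pi)) - Im (f 0).
  by apply: (@continuous_FTC (fun x => Im (f x)) (fun x => Im (f' x)) _ _ p0 _
    c2) => x; have [] := df x.
by apply: complex_ext; rewrite !reimE.
Qed.

Lemma cis_int2pi (m : int) : cis (m%:~R * (2 * pi : R)) = 1.
Proof.
have nat (n : nat) : cis (n%:R * (2 * pi : R)) = 1.
  by rewrite -cisX cis_2pi expr1n.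
case: m => n; first exact: nat.
by rewrite NegzE mulrNz mulNr cisN nat rmorph1.
Qed.

Lemma circle_mean_cis (m : int) :
  circle_mean (fun x => cis (m%:~R * x)) = (m == 0)%:R :> R[i].
Proof.
have [->|m0] := eqVneq m 0.
  rewrite -[RHS](circle_mean_cst 1); apply: circle_mean_ext => x _.
  by rewrite mul0r cis0.
have im0 : 'i * (m%:~R : R)%:C != 0 :> R[i].
  by rewrite mulf_neq0// ?eq_complex/= ?oner_eq0 ?andbF// eqxx andbT intr_eq0.
have cc : ccontinuous (fun x : R => cis (m%:~R * x)).
  exact: (cderiv_continuous (cderiv_cis _)).
(* Multiplied by i m, the integrand is the derivative of a periodic function, so its mean is
   zero. *)
apply: (mulfI im0); rewrite mulr0 -circle_meanZ; last first.
  exact: ccontinuous_cintegrable.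
rewrite (circle_mean_deriv (cderiv_cis m%:~R)); last first.
  exact: ccontinuousM (ccontinuous_cst _) cc.
by rewrite cis_int2pi mulr0 cis0 subrr mulr0.
Qed.

End ComplexDerivative.

(** * The Hardy space and uniqueness in the resolvent equation *)

Section HardySpace.
Variable R : realType.
Implicit Types (f g k : R -> R[i]) (c u : R[i]).

Local Notation Re := complex.Re.
Local Notation Im := complex.Im.
Local Notation "z ^*" := (Num.conj z) : complex_scope.

(** Extends [ket] to negative frequencies; [Negz n] is the frequency -(n + 1). *)
Definition mode (m : int) : R -> R[i] := fun x => cis (m%:~R * x).

Lemma ccontinuous_mode m : ccontinuous (mode m).
Proof. exact: (cderiv_continuous (cderiv_cis _)). Qed.

Lemma L2_mode m : L2_circle (mode m).
Proof. exact: ccontinuous_L2 (ccontinuous_mode m). Qed.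
#[local] Hint Resolve L2_mode : core.

Lemma mode_conj_mul m p x : (mode m x)^* * mode p x = mode (p - m) x.
Proof.
by rewrite /mode -cisN -cisD -mulNr -mulrDl addrC mulrzBr.
Qed.

Lemma orthonormal_mode (m : nat -> int) : injective m ->
  orthonormal (fun h => mode (m h)).
Proof.
move=> im; split=> [h //|h l]; rewrite /bracket.
rewrite (@circle_mean_ext _ _ (mode (m l - m h))); last first.
  by move=> x _; exact: mode_conj_mul.
by rewrite circle_mean_cis subr_eq0 (inj_eq im) eq_sym.
Qed.

Lemma ketE h : @ket R h = mode h.
Proof. by apply/funext => x; rewrite /ket cisX. Qed.

Lemma L2_ket h : L2_circle (@ket R h).
Proof. by rewrite ketE. Qed.
#[local] Hint Resolve L2_ket : core.

Lemma orthonormal_ket : orthonormal (@ket R).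
Proof.
have -> : @ket R = (fun h : nat => mode h) by apply/funext => h; exact: ketE.
by apply: orthonormal_mode => a b [].
Qed.

Lemma horner_ket (P : {poly R[i]}) x :
  P.[cis x] = \sum_(h < size P) P`_h * ket h x.
Proof. by rewrite horner_coef. Qed.

Lemma Hardy_L2 f : Hardy f -> L2_circle f. Proof. by case. Qed.

Lemma norm2_ext f g : f =1 g -> norm2 f = norm2 g.
Proof. by move=> /funext ->. Qed.

Lemma norm2D_le f g : L2_circle f -> L2_circle g ->
  norm2 (fun x => f x + g x) <= 2 * norm2 f + 2 * norm2 g.
Proof.
move=> hf hg.
have e1 := norm2_sub 1 hf hg; have e2 := norm2_sub (-1) hf hg.
have h := norm2_ge0 (fun x => g x - 1 * f x); rewrite e1 in h.
rewrite (@norm2_ext _ (fun x => g x - -1 * f x)); last first.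
  by move=> x; rewrite mulN1r opprK addrC.
rewrite e2; move: h; move: (bracket f g) (norm2 f) (norm2 g) => b p q.
rewrite /sqn !reimE /=; nra.
Qed.

Lemma L2_horner (P : {poly R[i]}) : L2_circle (fun x => P.[cis x]).
Proof.
rewrite (_ : (fun x => _) = (fun x => \sum_(h < size P) P`_h * ket h x)).
  exact: L2_circle_sum.
by apply/funext => x; rewrite horner_ket.
Qed.

Lemma HardyD f g : Hardy f -> Hardy g -> Hardy (fun x => f x + g x).
Proof.
move=> [hf af] [hg ag]; split; first exact: L2_circleD.
move=> e e0; have e4 : 0 < e / 4 by rewrite divr_gt0.
have [P hP] := af _ e4; have [Q hQ] := ag _ e4.
exists (P + Q); apply: (@le_lt_trans _ _
  (norm2 (fun x => (f x - P.[cis x]) + (g x - Q.[cis x])))).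
  by rewrite le_eqVlt; apply/orP; left; apply/eqP; apply: norm2_ext => x;
    rewrite hornerD; ring.
apply: le_lt_trans (norm2D_le _ _) _; [exact: L2_circleB (L2_horner _)..|].
lra.
Qed.

Lemma norm2Z c f : L2_circle f -> norm2 (fun x => c * f x) = sqn c * norm2 f.
Proof.
move=> hf; have hcf := L2_circleZ c hf.
rewrite {1}/norm2 bracketZr// bracketZl// bracket_self.
move: (norm2 f) => p; rewrite /sqn !reimE; ring.
Qed.

Lemma HardyZ c f : Hardy f -> Hardy (fun x => c * f x).
Proof.
move=> [hf af]; split; first exact: L2_circleZ.
move=> e e0; have s1 : 0 < sqn c + 1 by rewrite ltr_wpDl// sqn_ge0.
have [P hP] := af _ (divr_gt0 e0 s1).
exists (c *: P); rewrite (@norm2_ext _ (fun x => c * (f x - P.[cis x]))).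
  rewrite norm2Z; last exact: L2_circleB (L2_horner _).
  rewrite ltr_pdivlMr// in hP.
  apply: le_lt_trans hP; rewrite [leRHS]mulrDr mulr1 mulrC lerDl; exact: norm2_ge0.
by move=> x; rewrite hornerZ mulrBr.
Qed.

Lemma HardyB f g : Hardy f -> Hardy g -> Hardy (fun x => f x - g x).
Proof.
move=> hf hg; have := HardyD hf (HardyZ (-1) hg).
by under eq_fun do rewrite mulN1r.
Qed.

Lemma Hardy_horner (P : {poly R[i]}) : Hardy (fun x => P.[cis x]).
Proof.
split; first exact: L2_horner; move=> e e0; exists P.
have := norm2Z 0 (L2_horner P); rewrite /sqn !reimE expr0n addr0 mul0r => h.
apply: le_lt_trans e0; rewrite le_eqVlt; apply/orP; left; apply/eqP.
by rewrite -h; apply: norm2_ext => x; rewrite subrr mul0r.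
Qed.

Lemma ler_eps_mul (a b : R) : (forall e, 0 < e -> a <= e * b) -> 0 <= b ->
  a <= 0.
Proof.
move=> h b0; rewrite leNgt; apply/negP => a0.
have b1 : 0 < b + 1 by rewrite ltr_wpDl.
have /h : 0 < a / (b + 1) by rewrite divr_gt0.
by rewrite mulrAC ler_pdivlMr// ler_pM2l// gerDl ler10.
Qed.

(** Subtracting from k a polynomial in w does not change the bracket with f, and Cauchy-Schwarz
    bounds it once the polynomial is close to k. *)
Lemma Hardy_orthogonal f k : L2_circle f -> Hardy k ->
  (forall h, bracket (ket h) f = 0) -> bracket k f = 0.
Proof.
move=> hf [hk ak] f0; apply: sqn_eq0; apply/eqP.
rewrite eq_le sqn_ge0 andbT; apply: (@ler_eps_mul _ (norm2 f)); last first.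
  exact: norm2_ge0.
move=> e e0; have [P hP] := ak _ e0.
have -> : bracket k f = bracket (fun x => k x - P.[cis x]) f.
  rewrite bracketBl//; last exact: L2_horner.
  rewrite (_ : (fun x => _) = (fun x => \sum_(h < size P) P`_h * ket h x)).
    rewrite bracket_suml// big1 ?subr0// => h _.
    by rewrite f0 mulr0.
  by apply/funext => x; rewrite horner_ket.
apply: le_trans (cauchy_schwarz _ hf) _; first exact: L2_circleB (L2_horner _).
by rewrite ler_wpM2r ?norm2_ge0// ltW.
Qed.

(* Truncating the expansion of g, <g|D g> is a limit of sums of
   h |<h|g>|^2. *)
Lemma D_bullet_real g d : D_bullet g d -> Im (bracket g d) = 0.
Proof.
move=> [[hg ag] [hd _] gd]; apply/eqP; rewrite -sqrf_eq0 eq_le sqr_ge0 andbT.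
apply: (@ler_eps_mul _ (norm2 d)); last exact: norm2_ge0.
move=> e e0; have [P hP] := ag _ e0.
(* For P itself the bracket with d need not be real. The truncated expansion S makes it real, and
   best approximation keeps S as close to g as P. *)
set S := fun x => \sum_(h < size P) bracket (ket h) g * ket h x.
have hS : L2_circle S.
  exact: (L2_circle_sum (fun h => bracket (ket h) g)).
have gS : norm2 (fun x => g x - S x) <= e.
  apply: le_trans (ltW hP).
  apply: le_trans (best_approximation (fun h => P`_h) _ orthonormal_ket hg) _.
  rewrite le_eqVlt; apply/orP; left; apply/eqP; apply: norm2_ext => x.
  by rewrite horner_ket.
have -> : Im (bracket g d) = Im (bracket (fun x => g x - S x) d).
  rewrite bracketBl// Im_add Im_opp.
  suff -> : Im (bracket S d) = 0 by rewrite subr0.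
  rewrite (bracket_suml (fun h => bracket (ket h) g))//.
  apply: (big_ind (fun z => Im z = 0)) => [//|a b|h _].
    by rewrite Im_add => -> ->; rewrite addr0.
  rewrite gd mulrCA conj_mul_self -(rmorph_nat (real_complex R)) -realCM.
  exact: Im_real.
apply: (@le_trans _ _ (sqn (bracket (fun x => g x - S x) d))).
  by rewrite /sqn lerDr sqr_ge0.
apply: le_trans (cauchy_schwarz _ hd) _; first exact: L2_circleB.
by rewrite ler_wpM2r// norm2_ge0.
Qed.

(** Testing the difference of the two equations against F = f1 - f2 gives u |F|^2 equal to a real
    number, because the operator is symmetric. As Im u is nonzero, F has norm zero, and
    Cauchy-Schwarz kills its bracket with any k. *)
Lemma resolvent_unique eps (v : R -> R) u g f1 f2 l1 l2 k :
  Im u != 0 -> L2_circle k -> L2_circle g ->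
  L_bullet eps v f1 l1 -> L2_eq (fun x => u * f1 x - l1 x) g ->
  L_bullet eps v f2 l2 -> L2_eq (fun x => u * f2 x - l2 x) g ->
  bracket k f1 = bracket k f2.
Proof.
move=> u0 hk hg L1 e1 L2 e2.
case: (L1) => d1 [p1 [[hf1 hd1 c1] [hv1 hp1 o1] hl1 a1]].
case: (L2) => d2 [p2 [[hf2 hd2 c2] [hv2 hp2 o2] hl2 a2]].
have [Lf1 Ld1 Lp1] := And3 (Hardy_L2 hf1) (Hardy_L2 hd1) (Hardy_L2 hp1).
have [Lf2 Ld2 Lp2] := And3 (Hardy_L2 hf2) (Hardy_L2 hd2) (Hardy_L2 hp2).
have [Ll1 Ll2] := conj (Hardy_L2 hl1) (Hardy_L2 hl2).
pose F x := f1 x - f2 x; pose D x := d1 x - d2 x.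
have hF : Hardy F by exact: HardyB.
have LF := Hardy_L2 hF.
have FD : Im (bracket F D) = 0.
  apply: D_bullet_real; split; [done|exact: HardyB|move=> h].
  by rewrite !bracketBr// c1 c2 mulrBr.
have br f d p l (Lf : L2_circle f) (Ld : L2_circle d) (Lp : L2_circle p)
    (Ll : L2_circle l) (e : L2_eq l (fun x => - eps%:C * d x + p x))
    (eg : L2_eq (fun x => u * f x - l x) g) :
    u * bracket F f - (- eps%:C * bracket F d + bracket F p) = bracket F g.
  rewrite -(bracket_L2_eq _ _ LF eg)//; last first.
    by apply: L2_circleB => //; exact: L2_circleZ.
  rewrite bracketBr ?bracketZr//; last exact: L2_circleZ.
  rewrite (bracket_L2_eq _ _ LF e)//; last first.
    by apply: L2_circleD => //; exact: L2_circleZ.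
  by rewrite bracketDr ?bracketZr//; exact: L2_circleZ.
have E1 := br _ _ _ _ Lf1 Ld1 Lp1 Ll1 a1 e1.
have E2 := br _ _ _ _ Lf2 Ld2 Lp2 Ll2 a2 e2.
have P1 : bracket F (mult_op v f1) - bracket F p1 = 0 by rewrite -bracketBr// o1.
have P2 : bracket F (mult_op v f2) - bracket F p2 = 0 by rewrite -bracketBr// o2.
have vF : Im (bracket F (mult_op v f1) - bracket F (mult_op v f2)) = 0.
  rewrite -bracketBr//; apply: circle_mean_real => x.
  rewrite /mult_op -mulrBr mulrCA -/(F x) conj_mul_self -realCM.
  exact: Im_real.
have FF : bracket F F = bracket F f1 - bracket F f2 by rewrite bracketBr.
have FD' : bracket F D = bracket F d1 - bracket F d2 by rewrite bracketBr.
have key : u * bracket F F = - eps%:C * bracket F D +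
    (bracket F (mult_op v f1) - bracket F (mult_op v f2)).
  rewrite FF FD'; move/eqP: P1; rewrite subr_eq0 => /eqP ->.
  move/eqP: P2; rewrite subr_eq0 => /eqP ->.
  by move: E1; rewrite -E2 => /eqP; rewrite -subr_eq0 => /eqP E;
    apply/eqP; rewrite -subr_eq0; apply/eqP; rewrite -[RHS]E; ring.
have F0 : norm2 F = 0.
  have := congr1 (@complex.Im R) key; rewrite Im_add vF addr0 bracket_self.
  move: (bracket F D) (norm2 F) FD => z w z0.
  rewrite !Im_mul z0 mulr0 add0r Im_opp Im_real oppr0 mul0r Re_real.
  rewrite mulr0 add0r => /eqP; rewrite mulf_eq0 (negbTE u0) => /eqP //.
apply/eqP; rewrite -subr_eq0 -bracketBr//; apply/eqP; apply: sqn_eq0.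
apply/eqP; rewrite eq_le sqn_ge0 andbT.
by apply: le_trans (cauchy_schwarz hk LF) _; rewrite F0 mulr0.
Qed.

End HardySpace.

(** * Fourier series of smooth periodic functions *)

Section Fourier.
Variable R : realType.
Implicit Types (f g : R -> R[i]) (c z : R[i]) (x t : R).

Local Notation Re := complex.Re.
Local Notation Im := complex.Im.
Local Notation "z ^*" := (Num.conj z) : complex_scope.
Local Notation normc := (@Normc.normc R).
#[local] Hint Resolve L2_mode : core.
#[local] Hint Resolve L2_ket : core.

Lemma normc_sqrt z : normc z = Num.sqrt (sqn z).
Proof. by case: z. Qed.

Lemma normc_ge0 z : 0 <= normc z.
Proof. by rewrite normc_sqrt sqrtr_ge0. Qed.

Lemma sqr_normc_sqn z : normc z ^+ 2 = sqn z.
Proof. by rewrite normc_sqrt sqr_sqrtr// sqn_ge0. Qed.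

Lemma normc_le z (B : R) : 0 <= B -> (normc z <= B) = (sqn z <= B ^+ 2).
Proof.
by move=> B0; rewrite -sqr_normc_sqn ler_sqr ?nnegrE ?normc_ge0.
Qed.

Lemma normcD_le z c : normc (z + c) <= normc z + normc c.
Proof. exact: le_normcD. Qed.

(** The derivative is existentially quantified, so closure under products goes by induction on k
    with no formula for iterated derivatives. *)
Fixpoint Cn (k : nat) f : Prop :=
  if k is k'.+1 then
    exists f' : R -> R[i], (forall x, cderiv f x (f' x)) /\ Cn k' f'
  else ccontinuous f.

Lemma Cn_pred k f : Cn k.+1 f -> Cn k f.
Proof.
elim: k f => [|k IH] f; first by move=> [f' [h _]]; exact: cderiv_continuous h.
by move=> [f' [h /IH hf']]; exists f'.
Qed.

Lemma Cn_continuous k f : Cn k f -> ccontinuous f.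
Proof. by elim: k => [//|k IH] /Cn_pred. Qed.

Lemma CnD k f g : Cn k f -> Cn k g -> Cn k (fun x => f x + g x).
Proof.
elim: k f g => [|k IH] f g; first exact: ccontinuousD.
move=> [f' [hf cf]] [g' [hg cg]]; exists (fun x => f' x + g' x); split.
  by move=> x; exact: cderivD.
exact: IH.
Qed.

Lemma CnM k f g : Cn k f -> Cn k g -> Cn k (fun x => f x * g x).
Proof.
elim: k f g => [|k IH] f g; first exact: ccontinuousM.
move=> hf0 hg0; have hf1 := Cn_pred hf0; have hg1 := Cn_pred hg0.
move: hf0 hg0 => [f' [hf cf]] [g' [hg cg]].
exists (fun x => f' x * g x + f x * g' x); split.
  by move=> x; exact: cderivM.
by apply: CnD; apply: IH.
Qed.

Lemma Cn_cst k c : Cn k (fun=> c).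
Proof.
elim: k c => [|k IH] c; first exact: ccontinuous_cst.
by exists (fun=> 0); split => [x|]; [exact: cderiv_cst|exact: IH].
Qed.

Lemma Cn_cexp k (a b : R[i]) : Cn k (fun x => cexp (a * x%:C + b)).
Proof.
elim: k => [|k IH]; first exact: (cderiv_continuous (cderiv_cexp a b)).
exists (fun x => a * cexp (a * x%:C + b)); split; first exact: cderiv_cexp.
by apply: CnM => //; exact: Cn_cst.
Qed.

Definition cperiodic f : Prop := forall x, f (x + 2 * pi) = f x.

Lemma cperiodic_int f x (m : int) : cperiodic f -> f (x + m%:~R * (2 * pi)) = f x.
Proof.
move=> pf; have nat (n : nat) y : f (y + n%:R * (2 * pi)) = f y.
  elim: n => [|n IH]; first by rewrite mul0r addr0.
  by rewrite -natr1 mulrDl mul1r addrA pf IH.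
case: m => n; first exact: nat.
by rewrite NegzE mulrNz mulNr -[LHS](nat n.+1) subrK.
Qed.

Lemma cderiv_shift f x a c : cderiv f (x + a) c ->
  cderiv (fun y => f (y + a)) x c.
Proof.
move=> [h1 h2]; have s := is_derive_shift x (1 : R) a.
split.
  by have := @is_derive1_comp _ (fun y => Re (f y)) _ x _ _ h1 s; rewrite mulr1.
by have := @is_derive1_comp _ (fun y => Im (f y)) _ x _ _ h2 s; rewrite mulr1.
Qed.

Lemma cperiodic_deriv f (f' : R -> R[i]) : (forall x, cderiv f x (f' x)) ->
  cperiodic f -> cperiodic f'.
Proof.
move=> h pf x; apply: cderiv_unique (h x).
by apply: cderiv_ext (cderiv_shift (h (x + 2 * pi))) => y; exact: pf.
Qed.

(** Integration by parts without boundary term: the product of f with the conjugate mode is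
    periodic, so its derivative has mean zero. *)
Lemma bracket_mode_deriv f (f' : R -> R[i]) (m : int) :
  (forall x, cderiv f x (f' x)) -> ccontinuous f' -> cperiodic f ->
  bracket (mode m) f' = 'i * m%:~R%:C * bracket (mode m) f.
Proof.
move=> df cf' pf; have cf := cderiv_continuous df.
have conjE x : (mode m x)^* = cis (- m%:~R * x) by rewrite -cisN mulNr.
have d x : cderiv (fun y => (mode m y)^* * f y) x
   ((- ('i * m%:~R%:C)) * (mode m x)^* * f x + (mode m x)^* * f' x).
  apply: cderivM => //; rewrite conjE.
  rewrite (_ : - ('i * m%:~R%:C) = 'i * (- m%:~R)%:C); last first.
    by apply: complex_ext; rewrite !reimE; ring.
  by apply: cderiv_ext (cderiv_cis _ _) => y; rewrite conjE.
have L1 := L2_mode R m; have Lf := ccontinuous_L2 cf.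
have Lf' := ccontinuous_L2 cf'.
have I := L2_cintegrable_mul L1 Lf; have I' := L2_cintegrable_mul L1 Lf'.
have cm : ccontinuous (fun x => (mode m x)^*).
  rewrite (_ : (fun x => _) = (fun x => cis (- m%:~R * x))).
    exact: (cderiv_continuous (cderiv_cis _)).
  by apply/funext => x; rewrite conjE.
have f2pi : f (2 * pi) = f 0 by rewrite -[2 * pi]add0r pf.
have := circle_mean_deriv d; rewrite f2pi /mode cis_int2pi mulr0 cis0 subrr.
rewrite mulr0 -/(mode m) => e; apply/eqP; rewrite -subr_eq0; apply/eqP.
rewrite -[RHS]e; last first.
  by apply: ccontinuousD; apply: ccontinuousM => //;
    apply: ccontinuousM => //; exact: ccontinuous_cst.
rewrite /bracket -mulNr -circle_meanZ// addrC -circle_meanD//; last first.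
  exact: cintegrableZ.
by apply: circle_mean_ext => x _; rewrite -mulrA.
Qed.

(** With s = sin t, the inequality t cos t <= sin t gives t^2 (1 - s^2) <= s^2, that is t^2 <= (1 +
    t^2) s^2. The 5 is 1 + 4, since pi/2 is at most 2. *)
Lemma sqr_sin_lower t : `|t| <= pi / 2 -> t ^+ 2 / 5 <= sin t ^+ 2.
Proof.
wlog t0 : t / 0 <= t => [hw|].
  have [t0|t0] := leP 0 t; first exact: hw.
  by have := hw (- t); rewrite oppr_ge0 normrN sinN !sqrrN; apply; exact: ltW.
rewrite ger0_norm// => t2.
have [/andP[_ pi2] _] := pihalf_02_cos_pihalf R.
have pi0 := pi_gt0 R; have tpi : t <= pi by lra.
(* The difference sin y - y cos y vanishes at 0 and has derivative y sin y, nonnegative up to pi. *)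
have hs : t * cos t <= sin t.
  have d (x : R) : is_derive x (1 : R) (fun y => sin y - y * cos y) (x * sin x).
    have h := is_deriveB (is_derive_sin x)
      (is_deriveM (is_derive_id x (1 : R)) (is_derive_cos x)).
    by apply: is_derive_eq h _; rewrite /GRing.scale/=; ring.
  have dc : continuous (fun y : R => sin y - y * cos y).
    move=> x; apply: differentiable_continuous; apply/derivable1_diffP.
    exact: (@ex_derive _ _ _ _ _ _ _ (d x)).
  have [c] := MVT_segment t0 (fun x _ => d x) (continuous_subspaceT dc).
  rewrite in_itv/= => /andP[c0 ct]; rewrite sin0 mul0r !subr0 => e.
  rewrite -subr_ge0 e mulr_ge0// mulr_ge0//.
  have [->|] := eqVneq c pi; first by rewrite sinpi.
  rewrite neq_lt => /orP[cpi|]; last by rewrite ltNge (le_trans ct).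
  by apply: sin_ge0_pi; rewrite c0 ltW.
have c0 : 0 <= cos t by apply: cos_ge0_pihalf; apply/andP; split; lra.
have : (t * cos t) ^+ 2 <= sin t ^+ 2.
  by rewrite ler_sqr ?nnegrE ?mulr_ge0// (le_trans _ hs)// mulr_ge0.
have := cos2Dsin2 t; have := sqr_ge0 (sin t); move: (sin t) (cos t) => s c.
move=> s0 e; rewrite exprMn (_ : c ^+ 2 = 1 - s ^+ 2); last by lra.
have : t ^+ 2 <= 4 by nra.
by move: (t ^+ 2) (s ^+ 2) s0 => T S S0 T4; nra.
Qed.

(** |e^(it) - 1|^2 = 4 sin^2 (t/2), which reduces to the previous bound at t/2. *)
Lemma sqn_cis_sub1 t : `|t| <= pi -> t ^+ 2 / 5 <= sqn (cis t - 1).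
Proof.
move=> tpi; have h : `|t / 2| <= pi / 2.
  by rewrite normrM (@gtr0_norm _ 2^-1)// ler_pM2r.
have := sqr_sin_lower h; have e : t = (t / 2) *+ 2 by lra.
move: (t / 2) e => w ->; rewrite /sqn !reimE cos_mulr2n sin_mulr2n.
have := cos2Dsin2 w; move: (sin _) (cos _) => s c e1 hs.
have -> : c ^+ 2 *+ 2 - 1 - 1 = - 2 * s ^+ 2 by lra.
rewrite (_ : (c * s *+ 2 - 0) ^+ 2 = 4 * c ^+ 2 * s ^+ 2); last by ring.
have -> : c ^+ 2 = 1 - s ^+ 2 by lra.
rewrite (_ : _ + _ = 4 * s ^+ 2); last by ring.
by rewrite (_ : (w *+ 2) ^+ 2 = 4 * w ^+ 2); [lra|ring].
Qed.

Lemma angle_reduction t : exists m : int, `|t + m%:~R * (2 * pi)| <= pi.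
Proof.
have p0 : 0 < 2 * pi :> R by rewrite mulr_gt0// pi_gt0.
exists (- Num.floor ((t + pi) / (2 * pi))).
have /andP[] := floor_itv ((t + pi) / (2 * pi)).
rewrite ler_pdivlMr// ltr_pdivrMr//.
move: (Num.floor _) => k; rewrite intrD mulr1z mulrNz.
have -> : (k%:~R + 1) * (2 * pi) = k%:~R * (2 * pi) + 2 * pi :> R by ring.
rewrite mulNr; move: (_%:~R * _) => a h1 h2.
by rewrite ler_norml; apply/andP; split; lra.
Qed.

(** The factor 2 arises because the mean value theorem is applied to the real and imaginary parts
    separately, at different points. *)
Lemma cderiv_lipschitz f (f' : R -> R[i]) a b B : a <= b -> 0 <= B ->
  (forall x, cderiv f x (f' x)) -> (forall x, a <= x <= b -> sqn (f' x) <= B) ->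
  sqn (f b - f a) <= 2 * B * (b - a) ^+ 2.
Proof.
move=> ab B0 df hB; have [c1 c2] := cderiv_continuous df.
have [p] := MVT_segment ab (fun x _ => (df x).1) (continuous_subspaceT c1).
have [q] := MVT_segment ab (fun x _ => (df x).2) (continuous_subspaceT c2).
rewrite !in_itv/= => /hB qB e2 /hB pB e1.
rewrite /sqn !reimE e1 e2 !exprMn.
have : Re (f' p) ^+ 2 <= B by apply: le_trans pB; rewrite lerDl sqr_ge0.
have : Im (f' q) ^+ 2 <= B by apply: le_trans qB; rewrite lerDr sqr_ge0.
have := sqr_ge0 (b - a); move: ((b - a) ^+ 2) (_ ^+ 2) (_ ^+ 2) => d u v.
nra.
Qed.

(* The difference quotient f(x) - f(x0) over e^(ix) - e^(i x0) is bounded, as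
   x is within pi of x0 modulo the period. *)
Lemma lipschitz_cis f (f' : R -> R[i]) x0 : (forall x, cderiv f x (f' x)) ->
  ccontinuous f' -> cperiodic f ->
  exists2 C, 0 <= C & forall x, sqn (f x - f x0) <= C * sqn (cis x - cis x0).
Proof.
move=> df cf' pf.
have [B B0 hB] := ccontinuous_bounded (x0 - pi) (x0 + pi) cf'.
(* The constant is the 2 B of [cderiv_lipschitz] times the 5 of [sqn_cis_sub1]. *)
exists (10 * B); first by rewrite mulr_ge0.
move=> x; have [m] := angle_reduction (x - x0).
set t := x - x0 + _ => tpi.
have <- : f (x0 + t) = f x.
  by rewrite -[RHS](@cperiodic_int _ _ m)//; congr f; rewrite /t; ring.
have -> : cis x - cis x0 = cis x0 * (cis t - 1).
  rewrite mulrBr mulr1 -cisD; congr (_ - _).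
  have := @cperiodic_int (@cis R) x m; rewrite /t => <-; first by congr cis; ring.
  by move=> y; rewrite cisD cis_2pi mulr1.
rewrite sqnM sqn_cis mul1r.
apply: le_trans (_ : 2 * B * t ^+ 2 <= _); last first.
  have := sqn_cis_sub1 tpi; move: (sqn _) (t ^+ 2) => s T h; nra.
move: tpi; rewrite ler_norml => /andP[t1 t2].
have [t0|t0] := leP 0 t.
  have := @cderiv_lipschitz f f' x0 (x0 + t) B.
  rewrite [x0 + t - x0]addrAC subrr add0r; apply => //; first by rewrite lerDl.
  by move=> y /andP[y1 y2]; apply: hB; apply/andP; split; lra.
have := @cderiv_lipschitz f f' (x0 + t) x0 B.
rewrite (_ : x0 - (x0 + t) = - t); last by ring.
rewrite sqrrN (_ : sqn (f x0 - f (x0 + t)) = sqn (f (x0 + t) - f x0)).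
  apply => //; first by lra.
  by move=> y /andP[y1 y2]; apply: hB; apply/andP; split; lra.
by rewrite /sqn !reimE; ring.
Qed.

(** If all coefficients from N on were at least d, the sums in Bessel's inequality would be
    unbounded. *)
Lemma bessel_small (e : nat -> R -> R[i]) g (N : nat) (d : R) :
  orthonormal e -> L2_circle g -> 0 < d ->
  exists2 M, (N <= M)%N & sqn (bracket (e M) g) < d.
Proof.
move=> oe hg d0; apply: contrapT => h.
have big M : (N <= M)%N -> d <= sqn (bracket (e M) g).
  by move=> NM; rewrite leNgt; apply/negP => hM; apply: h; exists M.
have low K : K%:R * d <= \sum_(h < N + K) sqn (bracket (e h) g).
  elim: K => [|K IH].
    by rewrite mul0r; apply: sumr_ge0 => i _; exact: sqn_ge0.
  rewrite addnS big_ord_recr/= -natr1 mulrDl mul1r lerD// big//.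
  exact: leq_addr.
have [K hK] : exists K : nat, norm2 g < K%:R * d.
  exists (Num.bound (norm2 g / d)).
  rewrite -ltr_pdivrMr//; apply: le_lt_trans (archi_boundP _); rewrite ?ler_norm//.
  by rewrite divr_ge0 ?norm2_ge0// ltW.
by have := lt_le_trans hK (le_trans (low K) (bessel _ oe hg)); rewrite ltxx.
Qed.

End Fourier.

(** * Convergence of Fourier series *)

Section FourierSeries.
Variable R : realType.
Implicit Types (f g : R -> R[i]) (c z : R[i]) (x t : R).

Local Notation Re := complex.Re.
Local Notation Im := complex.Im.
Local Notation "z ^*" := (Num.conj z) : complex_scope.
Local Notation normc := (@Normc.normc R).
#[local] Hint Resolve L2_mode : core.
#[local] Hint Resolve L2_ket : core.

Lemma sqnV z : sqn z^-1 = (sqn z)^-1.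
Proof.
have [->|z0] := eqVneq z 0; first by rewrite invr0 /sqn/= expr0n/= addr0 invr0.
have s0 : sqn z != 0 by apply: contraNneq z0 => /sqn_eq0 ->.
by apply: (mulIf s0); rewrite -sqnM mulVf// mulVf// /sqn/= expr0n/= addr0 expr1n.
Qed.

Lemma invcE z : z^-1 = ((sqn z)^-1)%:C * z^*.
Proof.
have [->|z0] := eqVneq z 0; first by rewrite invr0 rmorph0 mulr0.
have s0 : sqn z != 0 by apply: contraNneq z0 => /sqn_eq0 ->.
by apply: (mulIf z0); rewrite mulVf// -mulrA conj_mul_self -realCM mulVf.
Qed.

(** The quotient may be discontinuous where g vanishes. It is still bounded, and measurable because
    the reciprocal of [sqn (g x)] is a power function. *)
Lemma L2_circle_div f g (C : R) : ccontinuous f -> ccontinuous g ->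
  (forall x, sqn (f x) <= C * sqn (g x)) -> 0 <= C ->
  L2_circle (fun x => f x / g x).
Proof.
move=> [f1 f2] [g1 g2] fg C0.
have mc (u : R -> R) : continuous u ->
    measurable_fun (@circle R) (u : R -> measurableTypeR R).
  by move=> cu; apply: measurable_funTS; exact: continuous_measurable_fun.
have ms : measurable_fun (@circle R)
    ((fun x => (sqn (g x))^-1) : R -> measurableTypeR R).
  rewrite (_ : (fun x => _) = (@powR R)^~ (-1) \o (fun x => sqn (g x))).
    apply: measurableT_comp; first exact: measurable_powR.
    by apply: measurable_funD; apply: measurable_funX; exact: mc.
  by apply/funext => x /=; rewrite powR_inv1// sqn_ge0.
apply: (@bounded_L2_circle _ _ C).
- rewrite (_ : (fun x => _) = (fun x => (sqn (g x))^-1 *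
      (Re (f x) * Re (g x) + Im (f x) * Im (g x)))).
    apply: measurable_funM => //.
    by apply: measurable_funD; apply: measurable_funM; exact: mc.
  by apply/funext => x; rewrite invcE !reimE; ring.
- rewrite (_ : (fun x => _) = (fun x => (sqn (g x))^-1 *
      (Im (f x) * Re (g x) - Re (f x) * Im (g x)))).
    apply: measurable_funM => //.
    by apply: measurable_funB; apply: measurable_funM; exact: mc.
  by apply/funext => x; rewrite invcE !reimE; ring.
- move=> x _; rewrite sqnM sqnV.
  have [->|g0] := eqVneq (sqn (g x)) 0; first by rewrite invr0 mulr0.
  by rewrite ler_pdivrMr// lt_neqAle eq_sym g0 sqn_ge0.
Qed.

Definition fourier_sum f (N : nat) : R -> R[i] :=
  fun x => \sum_(h < N) bracket (ket h) f * ket h x.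

(* Chernoff's argument: writing f(x) - f(x0) = g(x) (e^(ix) - e^(i x0)), the
   Fourier series of f at x0 telescopes to Fourier coefficients of g. *)
Lemma fourier_sum_cluster f (f' : R -> R[i]) x0 (N : nat) (d : R) :
  (forall x, cderiv f x (f' x)) -> ccontinuous f' -> cperiodic f ->
  (forall n : nat, bracket (mode (Negz n)) f = 0) -> 0 < d ->
  exists2 M, (N <= M)%N & sqn (f x0 - fourier_sum f M x0) < d.
Proof.
move=> df cf' pf f0 d0; have cf := cderiv_continuous df.
have [C C0 fC] := lipschitz_cis x0 df cf' pf.
pose q x := cis x - cis x0 : R[i].
pose g x := (f x - f x0) / q x.
have ccis : ccontinuous (@cis R).
  rewrite (_ : @cis R = mode 1); first exact: ccontinuous_mode.
  by apply/funext => x; rewrite /mode mul1r.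
have Lg : L2_circle g.
  apply: (@L2_circle_div _ _ C) => //.
    exact: ccontinuousD cf (ccontinuous_cst _).
  exact: ccontinuousD ccis (ccontinuous_cst _).
(* Where q vanishes, the quotient g takes the default value 0; the Lipschitz bound makes f x - f x0
   vanish there too, so the factorization holds everywhere. *)
have gE x : f x - f x0 = cis x * g x - cis x0 * g x.
  rewrite -mulrBl -/(q x) mulrC /g; have [q0|q0] := eqVneq (q x) 0.
    rewrite q0 mulr0; apply: sqn_eq0; apply/eqP; rewrite eq_le sqn_ge0 andbT.
    by rewrite (le_trans (fC x))// -/(q x) q0 /sqn/= expr0n addr0 mulr0.
  by rewrite divfK.
pose G m := bracket (mode m) g.
have Lf := ccontinuous_L2 cf.
have Lcg : L2_circle (fun x => cis x * g x).
  have [g1 g2 g3] := (L2_circleP g).1 Lg; have [c1 c2] := ccis.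
  have mc (u : R -> R) : continuous u ->
      measurable_fun (@circle R) (u : R -> measurableTypeR R).
    by move=> cu; apply: measurable_funTS; exact: continuous_measurable_fun.
  apply/L2_circleP; split.
  - rewrite (_ : (fun x => _) =
        (fun x => Re (cis x) * Re (g x) - Im (cis x) * Im (g x))).
      by apply: measurable_funB; apply: measurable_funM => //; exact: mc.
    by apply/funext => x; rewrite Re_mul.
  - rewrite (_ : (fun x => _) =
        (fun x => Re (cis x) * Im (g x) + Im (cis x) * Re (g x))).
      by apply: measurable_funD; apply: measurable_funM => //; exact: mc.
    by apply/funext => x; rewrite Im_mul.
  - by apply: intR_ext g3 => x; rewrite sqnM sqn_cis mul1r.
have FG m : bracket (mode m) f - (m == 0)%:R * f x0 = G (m - 1) - cis x0 * G m.
  transitivity (bracket (mode m) (fun x => f x - f x0)).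
    rewrite bracketBr//; last exact: L2_circle_cst.
    congr (_ - _); have := @bracketZr _ (mode 0) (mode m) (f x0).
    rewrite {2}/bracket (@circle_mean_ext _ _ (mode (0 - m))); last first.
      by move=> x _; exact: mode_conj_mul.
    rewrite circle_mean_cis sub0r oppr_eq0 mulrC => <-//.
    by apply: circle_mean_ext => x _; rewrite /mode mul0r cis0 mulr1.
  rewrite (_ : (fun x => _) = (fun x => cis x * g x - cis x0 * g x)); last first.
    by apply/funext => x; exact: gE.
  rewrite bracketBr//; last exact: L2_circleZ.
  rewrite bracketZr//; congr (_ - _).
  apply: circle_mean_ext => x _; rewrite mulrA; congr (_ * _).
  rewrite (_ : cis x = mode 1 x); last by rewrite /mode mul1r.
  by rewrite mode_conj_mul /mode -cisN -mulNr -mulrNz opprB.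
(* The phase turns the two-term recurrence [FG], multiplied by e^(i m x0), into an exact
   difference. *)
pose b m := G m * cis ((m + 1)%:~R * x0).
have sqb m : sqn (b m) = sqn (G m) by rewrite sqnM sqn_cis mulr1.
have bE m : cis (m%:~R * x0) * (bracket (mode m) f - (m == 0)%:R * f x0) =
    b (m - 1) - b m.
  rewrite FG /b subrK intrD mulrDl mulr1z mul1r cisD; ring.
(* The negative coefficients of f vanish, so b is constant on negative indices, and Bessel's
   inequality forces that constant to be zero. *)
have b0 : b (-1) = 0.
  have bN n : b (Negz n) = b (-1).
    elim: n => [//|n IH]; rewrite -IH.
    have := bE (Negz n); rewrite f0 sub0r mul0r oppr0 mulr0 => /esym/eqP.
    rewrite subr_eq0 => /eqP <-; congr b; rewrite !NegzE.
    by rewrite -[n.+2]addn1 PoszD opprD.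
  apply: sqn_eq0; apply/eqP; rewrite eq_le sqn_ge0 andbT.
  apply/ler_addgt0Pl => e e0; rewrite addr0.
  have oN : orthonormal (fun h => @mode R (Negz h)).
    by apply: orthonormal_mode => i j [].
  have [M _ hM] := bessel_small 0 oN Lg e0.
  by rewrite -(bN M) sqb ltW.
(* Summing [bE] over 0 <= m <= M leaves b (-1) - b M, where b (-1) = 0; the sum with M + 1 terms
   thus has error b M. *)
have tel M : f x0 - fourier_sum f M.+1 x0 = b M.
  rewrite /fourier_sum; elim: M => [|M IH].
    rewrite big_ord1; have := bE 0; rewrite sub0r b0 eqxx mul1r.
    rewrite mul0r cis0 mul1r ketE /mode mul0r cis0 mulr1 sub0r => e.
    by rewrite -[RHS]opprK -e opprB.
  rewrite big_ord_recr/= opprD addrA IH.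
  have := bE M.+1; rewrite mul0r subr0.
  have -> : M.+1%:Z - 1 = M by rewrite -[M.+1]addn1 PoszD addrK.
  by rewrite ketE mulrC /mode => ->; ring.
have oP : orthonormal (fun h : nat => @mode R h).
  by apply: orthonormal_mode => i j [].
have [M NM hM] := bessel_small N oP Lg d0.
by exists M.+1; [exact: leqW|rewrite tel sqb].
Qed.

(** Two integrations by parts; the constant is the L^2 norm of the second derivative. *)
Lemma fourier_coef_decay f : Cn 2 f -> cperiodic f ->
  exists2 B, 0 <= B & forall h : nat,
    (h%:R ^+ 2) * normc (bracket (ket h) f) <= B.
Proof.
move=> [f1 [d1 [f2 [d2 c2]]]] pf; have c1 := cderiv_continuous d2.
exists (Num.sqrt (norm2 f2)) => [|h]; first exact: sqrtr_ge0.
have Lf2 := ccontinuous_L2 c2.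
have p1 := cperiodic_deriv d1 pf.
have e : bracket (mode h) f2 =
    ('i * h%:~R%:C) * (('i * h%:~R%:C) * bracket (ket h) f).
  by rewrite ketE -(bracket_mode_deriv h d1 c1 pf) -(bracket_mode_deriv h d2 c2 p1).
have := cauchy_schwarz (L2_mode R h) Lf2.
have -> : norm2 (@mode R h) = 1.
  have [_ o] := orthonormal_ket R.
  by rewrite /norm2 -ketE o eqxx.
rewrite mul1r e -!sqr_normc_sqn !Normc.normcM => hh.
have n0 : normc 'i = 1 by rewrite normc_sqrt /sqn/= expr0n expr1n add0r sqrtr1.
have nh : normc (h%:~R)%:C = h%:R.
  by rewrite normc_sqrt /sqn/= expr0n addr0 sqrtr_sqr ger0_norm.
rewrite n0 nh mul1r mulrA -expr2 in hh.
apply: (le_trans (ler_norm _)).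
by rewrite -sqrtr_sqr ler_wsqrtr.
Qed.

(** Decay of the coefficients controls the distance between partial sums uniformly in x. Partial
    sums arbitrarily far out come close to f x, which identifies the limit. *)
Lemma fourier_sum_uniform f : Cn 2 f -> cperiodic f ->
  (forall n : nat, bracket (mode (Negz n)) f = 0) ->
  exists2 B, 0 <= B & forall x (n : nat),
    normc (f x - fourier_sum f n.+2 x) <= B / n.+1%:R.
Proof.
move=> hf pf f0; have [B B0 hB] := fourier_coef_decay hf pf.
have [f1 [d1 [f2 [d2 c2]]]] := hf; have c1 := cderiv_continuous d2.
exists B => // x n.
(* With r = n + 1 + k, the new term has size at most B / (r + 1)^2, hence at most B / r - B / (r +
   1), and these bounds telescope. Starting at n + 2 keeps r positive. *)
have tail k : normc (fourier_sum f (n.+2 + k) x - fourier_sum f n.+2 x) <=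
    B / n.+1%:R - B / (n.+1 + k)%:R.
  elim: k => [|k IH].
    by rewrite !addn0 !subrr /Normc.normc/= expr0n addr0 sqrtr0.
  rewrite !addnS {1}/fourier_sum big_ord_recr/= -/(fourier_sum f _ x) addrAC.
  apply: le_trans (normcD_le _ _) _.
  rewrite Normc.normcM (_ : normc (ket _ x) = 1); last first.
    by rewrite ketE normc_sqrt sqn_cis sqrtr1.
  rewrite mulr1; apply: le_trans (lerD IH (lexx _)) _.
  have := hB (n.+2 + k)%N; move: (normc _) => w hw.
  rewrite -addrA lerD2l -subr_ge0.
  have p1 : 0 < (n.+1 + k)%:R :> R by rewrite ltr0n.
  have e2 : (n.+2 + k)%:R = (n.+1 + k)%:R + 1 :> R by rewrite addSn natr1.
  rewrite e2 in hw; rewrite -addSn e2; move: p1 hw; move: (_%:R) => r r0 hw.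
  have r1 : 0 < r + 1 by rewrite addr_gt0.
  have : w <= B / (r + 1) ^+ 2 by rewrite ler_pdivlMr ?exprn_gt0// mulrC.
  have -> : - (B / (r + 1)) - (- (B / r) + w) =
      B / (r + 1) ^+ 2 - w + B / (r * (r + 1) ^+ 2).
    by field; rewrite !gt_eqF.
  move=> h; rewrite addr_ge0// ?subr_ge0// divr_ge0// mulr_ge0 ?sqr_ge0//.
  exact: ltW.
apply/ler_addgt0Pl => e e0.
have [M nM hM] := fourier_sum_cluster x n.+2 d1 c1 pf f0 (exprn_gt0 2 e0).
rewrite -(subrK (fourier_sum f M x) (f x)) -addrA.
apply: le_trans (normcD_le _ _) _; apply: lerD.
  by rewrite normc_le ?ltW.
have := tail (M - n.+2)%N; rewrite subnKC// => /le_trans; apply.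
by rewrite gerBl divr_ge0.
Qed.

Lemma fourier_Hardy f : Cn 2 f -> cperiodic f ->
  (forall n : nat, bracket (mode (Negz n)) f = 0) -> Hardy f.
Proof.
move=> hf pf f0; have [B B0 hB] := fourier_sum_uniform hf pf f0.
have Lf := ccontinuous_L2 (Cn_continuous hf).
split=> // e e0.
(* This n gives B^2 / (n + 1) < e, and the squared error (B / (n + 1))^2 is no larger than B^2 / (n
   + 1). *)
pose n := Num.bound (B ^+ 2 / e).
have hn : B ^+ 2 / e < n.+1%:R.
  have q0 : 0 <= B ^+ 2 / e by rewrite divr_ge0 ?sqr_ge0// ltW.
  by apply: lt_trans (archi_boundP q0) _; rewrite ltr_nat.
exists (\poly_(h < n.+2) bracket (ket h) f).
set S := fun x => _.
have SE x : S x = f x - fourier_sum f n.+2 x.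
  by rewrite /S horner_poly.
have LS : L2_circle S by exact: L2_circleB Lf (L2_horner _).
have b0 : 0 <= B / n.+1%:R by rewrite divr_ge0.
have [] := @circle_mean_bound _ (fun x => (S x)^* * S x) ((B / n.+1%:R) ^+ 2).
- exact: L2_cintegrable_mul.
- move=> x _; rewrite conj_mul_self SE.
  have := hB x n; rewrite normc_le// => h.
  rewrite /sqn Re_real Im_real expr0n addr0 ler_sqr ?nnegrE ?sqr_ge0//.
  exact: sqn_ge0.
- exact: sqr_ge0.
move=> h _; apply: (le_lt_trans (le_trans (ler_norm _) h)).
rewrite exprMn ltr_pdivrMr// in hn *.
have m1 : 1 <= n.+1%:R :> R by rewrite ler1n.
apply: (@le_lt_trans _ _ (B ^+ 2 / n.+1%:R)); last first.
  by rewrite ltr_pdivrMr ?ltr0n// mulrC.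
rewrite ler_wpM2l ?sqr_ge0// exprVn lef_pV2 ?posrE ?exprn_gt0 ?ltr0n//.
by rewrite expr2 ler_peMl.
Qed.

End FourierSeries.

(** * Analytic functions on a half plane *)

Section HalfPlane.
Variable R : realType.
Implicit Types (F G : R[i] -> R[i]) (a b c l z w : R[i]) (x y s t sg : R).

Local Notation Re := complex.Re.
Local Notation Im := complex.Im.
Local Notation normc := (@Normc.normc R).

Lemma normcE_norm z : `|z| = (normc z)%:C.
Proof. by rewrite normc_def normc_sqrt. Qed.

Lemma normc_ltE z (e : R) : (`|z| < e%:C) = (normc z < e).
Proof. by rewrite normcE_norm ltcR. Qed.

Lemma Re_normc z : `|Re z| <= normc z.
Proof.
by rewrite normc_sqrt -sqrtr_sqr ler_wsqrtr// /sqn lerDl sqr_ge0.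
Qed.

Lemma Im_normc z : `|Im z| <= normc z.
Proof.
by rewrite normc_sqrt -sqrtr_sqr ler_wsqrtr// /sqn lerDr sqr_ge0.
Qed.

Lemma normc_le_ReIm z : normc z <= `|Re z| + `|Im z|.
Proof.
rewrite normc_le ?addr_ge0// /sqn sqrrD !real_normK ?num_real//.
by rewrite -addrA lerD2l lerDr mulrn_wge0// mulr_ge0.
Qed.

(** Radii of balls in [R[i]^o] are complex numbers; a positive one is real. *)
Lemma ball_normc z (d : R[i]) : 0 < d -> exists2 d' : R, 0 < d' &
  forall w, normc (w - z) < d' -> ball (z : R[i]^o) d w.
Proof.
move=> d0; exists (Re d); first by move: d0; rewrite ltcE => /andP[].
move=> w h; rewrite -ball_normE /ball_/= -opprB normrN.
have -> : d = (Re d)%:C.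
  by apply: complex_ext => //; move: d0; rewrite ltcE => /andP[/eqP].
by rewrite normc_ltE.
Qed.

Lemma complex_derive_eps (G : R[i]^o -> R[i]^o) (z : R[i]^o) (l : R[i]^o)
    (e : R) :
  is_derive z (1 : R[i]^o) G l -> 0 < e ->
  exists2 d : R, 0 < d & forall h : R[i], h != 0 -> normc h < d ->
    normc (l - (G (z + h) - G z) / h) < e.
Proof.
move=> [dG vG] e0.
have ec : 0 < e%:C by rewrite ltcR.
have /cvg_ex[/= l' hl'] := dG.
have <- : l' = l by rewrite -vG; apply/esym/cvg_lim.
move/cvgrPdist_lt : hl' => /(_ _ ec).
rewrite near_withinE => /nbhs_ballP[d /= d0 hd].
have [d' d'0 hd'] := ball_normc 0 d0.
exists d' => // h h0 hh; rewrite -normc_ltE.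
have := hd h _ h0; rewrite /= /shift/= => H.
rewrite [_ / h]mulrC (addrC z).
have -> : h = h *: (1 : R[i]^o) by rewrite /GRing.scale/= mulr1.
rewrite [X in X^-1]/GRing.scale/= mulr1; apply: H.
by apply: hd'; rewrite subr0.
Qed.

(* Complex differentiability at z with derivative l, tested along every real
   line through z. *)
Definition holAt G z l : Prop :=
  forall a, cderiv (fun s : R => G (z + a * s%:C)) 0 (a * l).

Lemma is_derive_eps (f : R -> R) (l : R) :
  (forall e, 0 < e -> exists2 d, 0 < d & forall s, s != 0 -> `|s| < d ->
    `|l - (f s - f 0) / s| < e) -> is_derive (0 : R) (1 : R) f l.
Proof.
move=> h.
have H : h^-1 *: ((f \o shift 0) (h *: (1 : R)) - f 0) @[h --> 0^'] --> l.
  apply/cvgrPdist_lt => e /h[d d0 hd].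
  rewrite near_withinE; apply/nbhs_ballP; exists d => //= s.
  rewrite /ball/= sub0r normrN => sd s0; have := hd s s0 sd.
  by rewrite /GRing.scale/= mulr1 addr0 mulrC.
split; first by apply/cvg_ex; exists l.
exact/cvg_lim.
Qed.

Lemma is_derive_holAt (G : R[i]^o -> R[i]^o) (z : R[i]^o) (l : R[i]^o) :
  is_derive z (1 : R[i]^o) G l -> holAt G z l.
Proof.
move=> dG a; have [->|a0] := eqVneq a 0.
  rewrite mul0r; apply: cderiv_ext (cderiv_cst (G z) 0) => s.
  by rewrite mul0r addr0.
have na : 0 < normc a.
  rewrite lt_neqAle eq_sym normc_ge0 andbT.
  by apply: contra_neq a0; exact: Normc.eq0_normc.
have key (e : R) : 0 < e -> exists2 d, 0 < d & forall s : R, s != 0 ->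
    `|s| < d -> normc (a * l - (G (z + a * s%:C) - G z) / s%:C) < e.
  move=> e0; have [d d0 hd] := complex_derive_eps dG (divr_gt0 e0 na).
  exists (d / normc a); first by rewrite divr_gt0.
  move=> s s0; rewrite ltr_pdivlMr// => sd.
  have sC : s%:C != 0 by rewrite eq_complex/= eqxx andbT.
  have ns : normc (a * s%:C) = `|s| * normc a.
    by rewrite Normc.normcM mulrC /Normc.normc/= expr0n addr0 sqrtr_sqr.
  have := hd (a * s%:C); rewrite mulf_neq0// ns => /(_ isT sd).
  rewrite ltr_pdivlMr// -Normc.normcM; congr (normc _ < e).
  by field; apply/andP; split.
split; apply: is_derive_eps => e /key[d d0 hd]; exists d => // s s0 sd;
  apply: le_lt_trans (hd s s0 sd).
  apply: le_trans (Re_normc _); rewrite mulr0 addr0 le_eqVlt; apply/orP; left.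
  rewrite [_ / s%:C]mulrC -(fmorphV (real_complex R)) !reimE mul0r subr0.
  by rewrite [s^-1 * _]mulrC.
apply: le_trans (Im_normc _); rewrite mulr0 addr0 le_eqVlt; apply/orP; left.
rewrite [_ / s%:C]mulrC -(fmorphV (real_complex R)) !reimE mul0r addr0.
by rewrite [s^-1 * _]mulrC.
Qed.

Lemma holAtD F G z a b : holAt F z a -> holAt G z b ->
  holAt (fun w => F w + G w) z (a + b).
Proof. by move=> hF hG c; rewrite mulrDr; exact: cderivD. Qed.

Lemma holAtM F G z a b : holAt F z a -> holAt G z b ->
  holAt (fun w => F w * G w) z (a * G z + F z * b).
Proof.
move=> hF hG c; have := cderivM (hF c) (hG c).
rewrite mulr0 addr0; congr cderiv; ring.
Qed.

Lemma holAt_cst c z : holAt (fun=> c) z 0.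
Proof. by move=> a; rewrite mulr0; exact: cderiv_cst. Qed.

Lemma holAtZ c F z a : holAt F z a -> holAt (fun w => c * F w) z (c * a).
Proof.
by move=> hF; have := holAtM (holAt_cst c z) hF; rewrite mul0r add0r.
Qed.

Lemma holAt_affine F c w z a : holAt F (c + w * z) a ->
  holAt (fun v => F (c + w * v)) z (w * a).
Proof.
move=> hF b; rewrite mulrA [b * w]mulrC; apply: cderiv_ext (hF (w * b)) => s.
by congr F; ring.
Qed.

Lemma holAt_cexp a b z : holAt (fun w => cexp (a * w + b)) z
  (a * cexp (a * z + b)).
Proof.
move=> c; have := cderiv_cexp (a * c) (a * z + b) 0.
rewrite mulr0 add0r mulrA [c * a]mulrC; apply: cderiv_ext => s.
by congr cexp; ring.
Qed.

Definition plane_pt (p : R * R) : R[i] := p.1 +i* p.2.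

(** Continuity in two real variables, the form suited to compact rectangles and to integrals along
    lines. *)
Definition pcontinuous F : Prop :=
  continuous (fun p : R * R => Re (F (plane_pt p))) /\
  continuous (fun p : R * R => Im (F (plane_pt p))).

Lemma pcontinuous_id : pcontinuous id.
Proof. by split => p; [exact: cvg_fst|exact: cvg_snd]. Qed.

Lemma pcontinuous_cst c : pcontinuous (fun=> c).
Proof. by split => p; exact: cvg_cst. Qed.

Lemma pcontinuousD F G : pcontinuous F -> pcontinuous G ->
  pcontinuous (fun z => F z + G z).
Proof.
move=> [f1 f2] [g1 g2]; split => p.
  rewrite (_ : (fun p : R * R => _) =
    (fun p : R * R => Re (F (plane_pt p)) + Re (G (plane_pt p)))).
    by apply: cvgD; [exact: f1|exact: g1].
  by apply/funext => q; rewrite reimE.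
rewrite (_ : (fun p : R * R => _) =
  (fun p : R * R => Im (F (plane_pt p)) + Im (G (plane_pt p)))).
  by apply: cvgD; [exact: f2|exact: g2].
by apply/funext => q; rewrite reimE.
Qed.

Lemma pcontinuousM F G : pcontinuous F -> pcontinuous G ->
  pcontinuous (fun z => F z * G z).
Proof.
move=> [f1 f2] [g1 g2]; split => p.
  rewrite (_ : (fun p : R * R => _) = (fun p : R * R => Re (F (plane_pt p)) *
    Re (G (plane_pt p)) - Im (F (plane_pt p)) * Im (G (plane_pt p)))).
    by apply: cvgB; apply: cvgM; [exact: f1|exact: g1|exact: f2|exact: g2].
  by apply/funext => q; rewrite reimE.
rewrite (_ : (fun p : R * R => _) = (fun p : R * R => Re (F (plane_pt p)) *
  Im (G (plane_pt p)) + Im (F (plane_pt p)) * Re (G (plane_pt p)))).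
  by apply: cvgD; apply: cvgM; [exact: f1|exact: g2|exact: f2|exact: g1].
by apply/funext => q; rewrite reimE.
Qed.

Lemma pcontinuous_comp F G : pcontinuous F -> pcontinuous G ->
  pcontinuous (fun z => F (G z)).
Proof.
move=> [f1 f2] [g1 g2].
have cG : continuous (fun p : R * R =>
    (Re (G (plane_pt p)), Im (G (plane_pt p)))).
  by move=> p; exact: (cvg_pair (g1 p) (g2 p)).
have eG p : G (plane_pt p) =
  plane_pt (Re (G (plane_pt p)), Im (G (plane_pt p))).
  by apply: complex_ext.
split => p.
  rewrite (_ : (fun p : R * R => _) = (fun q => Re (F (plane_pt q))) \o
    (fun p => (Re (G (plane_pt p)), Im (G (plane_pt p))))).
    by apply: continuous_comp; [exact: cG|exact: f1].
  by apply/funext => q /=; rewrite {1}eG.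
rewrite (_ : (fun p : R * R => _) = (fun q => Im (F (plane_pt q))) \o
  (fun p => (Re (G (plane_pt p)), Im (G (plane_pt p))))).
  by apply: continuous_comp; [exact: cG|exact: f2].
by apply/funext => q /=; rewrite {1}eG.
Qed.

Lemma pcontinuous_affine F c w : pcontinuous F ->
  pcontinuous (fun z => F (c + w * z)).
Proof.
move=> cF; apply: (@pcontinuous_comp F (fun z => c + w * z)) => //.
apply: pcontinuousD; first exact: pcontinuous_cst.
by apply: pcontinuousM; [exact: pcontinuous_cst|exact: pcontinuous_id].
Qed.

Lemma pcontinuous_cexp : pcontinuous (@cexp R).
Proof.
have c1 : continuous (fun p : R * R => expR p.1).
  by move=> p; apply: (continuous_comp (@cvg_fst _ _ _ _ _)); exact: continuous_expR.
have c2 : continuous (fun p : R * R => cos p.2).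
  by move=> p; apply: (continuous_comp (@cvg_snd _ _ _ _ _)); exact: continuous_cos.
have c3 : continuous (fun p : R * R => sin p.2).
  by move=> p; apply: (continuous_comp (@cvg_snd _ _ _ _ _)); exact: continuous_sin.
split => p.
  rewrite (_ : (fun p : R * R => _) = (fun p : R * R => expR p.1 * cos p.2)).
    by apply: cvgM; [exact: c1|exact: c2].
  by apply/funext => q; rewrite /cexp !reimE mul0r subr0.
rewrite (_ : (fun p : R * R => _) = (fun p : R * R => expR p.1 * sin p.2)).
  by apply: cvgM; [exact: c1|exact: c3].
by apply/funext => q; rewrite /cexp !reimE mul0r addr0.
Qed.

(* The nearest point of the closed half plane; precomposing with it extends a
   function continuous there to a continuous function on the plane. *)
Definition clamp sg z : R[i] := Re z +i* (sg * Num.max (sg * Im z) 0).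

Lemma clamp_id sg z : sg * sg = 1 -> 0 <= sg * Im z -> clamp sg z = z.
Proof.
move=> sg1 h; apply: complex_ext; rewrite /clamp ?reimE//.
by rewrite max_l// mulrA sg1 mul1r.
Qed.

Lemma clamp_ge0 sg z : sg * sg = 1 -> 0 <= sg * Im (clamp sg z).
Proof. by move=> sg1; rewrite reimE mulrA sg1 mul1r le_max lexx orbT. Qed.

Lemma within_continuous_pcontinuous sg (F : R[i]^o -> R[i]^o) : sg * sg = 1 ->
  {within closed_half_plane sg, continuous F} ->
  pcontinuous (fun z => F (clamp sg z)).
Proof.
move=> sg1 /subspace_continuousP cF.
have key (p : R * R) (e : R) : 0 < e -> \forall q \near p,
    normc (F (clamp sg (plane_pt p)) - F (clamp sg (plane_pt q))) < e.
  move=> e0; set z := clamp sg (plane_pt p).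
  have hz : closed_half_plane sg z by exact: clamp_ge0.
  have ec : 0 < e%:C by rewrite ltcR.
  have /cvgrPdist_lt /(_ _ ec) := cF z hz.
  rewrite near_withinE => /nbhs_ballP[d /= d0 hd].
  have [d' d'0 hd'] := ball_normc z d0.
  have d2 : 0 < d' / 2 by rewrite divr_gt0.
  have c1 : (fun q : R * R => q.1) @ p --> p.1 by exact: cvg_fst.
  have c2 : (fun q : R * R => sg * Num.max (sg * q.2) 0) @ p -->
      sg * Num.max (sg * p.2) 0.
    apply: cvgMr.
    have cm : continuous ((fun q : R * R => sg * q.2) \max (fun=> 0)).
      apply: max_fun_continuous => q; last exact: cvg_cst.
      by apply: cvgMr; exact: cvg_snd.
    exact: cm.
  move/cvgrPdist_lt : c1 => /(_ _ d2) c1.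
  move/cvgrPdist_lt : c2 => /(_ _ d2) c2.
  near=> q; rewrite -normc_ltE; apply: hd; last exact: clamp_ge0.
  apply: hd'; rewrite -normcN opprB; apply: le_lt_trans (normc_le_ReIm _) _.
  rewrite [d']splitr; apply: ltrD; rewrite !reimE.
    by near: q; exact: c1.
  by near: q; exact: c2.
split => p; apply/cvgrPdist_lt => e e0; near=> q.
  apply: le_lt_trans (_ : normc (F (clamp sg (plane_pt p)) -
    F (clamp sg (plane_pt q))) < e).
    by apply: le_trans (Re_normc _); rewrite !reimE.
  by near: q; exact: key.
apply: le_lt_trans (_ : normc (F (clamp sg (plane_pt p)) -
  F (clamp sg (plane_pt q))) < e).
  by apply: le_trans (Im_normc _); rewrite !reimE.
by near: q; exact: key.
Unshelve. all: by end_near. Qed.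

Lemma holAt_clamp sg F z l : sg * sg = 1 -> 0 < sg * Im z -> holAt F z l ->
  holAt (fun w => F (clamp sg w)) z l.
Proof.
move=> sg1 z0 hF a; have [h1 h2] := hF a.
have ev : \forall s \near (0 : R),
    F (z + a * s%:C) = F (clamp sg (z + a * s%:C)).
  have cs : (fun s : R => sg * (Im z + Im a * s)) @ (0 : R) -->
      sg * (Im z + Im a * 0).
    apply: cvgMr; apply: cvgD; first exact: cvg_cst.
    by apply: cvgMr; exact: cvg_id.
  rewrite mulr0 addr0 in cs.
  have ev0 := cvgr_gt _ cs _ z0; near=> s.
  rewrite clamp_id// !reimE mulr0 add0r; apply: ltW.
  by near: s; exact: ev0.
split.
  by apply: near_eq_is_derive h1; near=> s; congr Re; near: s; exact: ev.
by apply: near_eq_is_derive h2; near=> s; congr Im; near: s; exact: ev.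
Unshelve. all: by end_near. Qed.

End HalfPlane.

(** * Maximum principle and uniqueness from boundary values *)

Section BoundaryUniqueness.
Variable R : realType.
Implicit Types (F G : R[i] -> R[i]) (a b c l z w : R[i]) (x y s t sg : R).

Local Notation Re := complex.Re.
Local Notation Im := complex.Im.

(** At an interior maximum f' 0 = 0. If k were positive, f' would be positive just to the right of
    0, and the mean value theorem would give larger values there. *)
Lemma second_derivative_test (f f' : R -> R) (k r : R) : 0 < r ->
  (forall s, `|s| < r -> is_derive s (1 : R) f (f' s)) ->
  is_derive (0 : R) (1 : R) f' k ->
  (forall s, `|s| < r -> f s <= f 0) -> k <= 0.
Proof.
move=> r0 df dk fmax; rewrite leNgt; apply/negP => k0.
have mem s : s \in `](- r), r[ -> `|s| < r by rewrite in_itv/= ltr_norml.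
have f'0 : f' 0 = 0.
  have rr : - r <= r by lra.
  have dmax := @derive1_at_max _ f (- r) r 0 rr
    (fun t ht => @ex_derive _ _ _ _ _ _ _ (df t (mem t ht))).
  have d0 : is_derive (0 : R) (1 : R) f 0.
    apply: dmax; first by rewrite in_itv/= r0 oppr_lt0 r0.
    by move=> t /mem; exact: fmax.
  have d1 : is_derive (0 : R) (1 : R) f (f' 0) by apply: df; rewrite normr0.
  rewrite -(@derive_val _ _ _ _ _ _ _ d1).
  by rewrite (@derive_val _ _ _ _ _ _ _ d0).
have /cvg_ex[/= k' hk'] := @ex_derive _ _ _ _ _ _ _ dk.
have ek : k' = k.
  by rewrite -(@derive_val _ _ _ _ _ _ _ dk); apply/esym/cvg_lim.
rewrite ek in hk'.
move/cvgrPdist_lt : hk' => /(_ _ k0).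
rewrite near_withinE => /nbhs_ballP[d /= d0 hd].
have pos s : 0 < s -> s < d -> 0 < f' s.
  move=> s0 sd; have := hd s; rewrite /ball/= sub0r normrN gtr0_norm//.
  rewrite gt_eqF// => /(_ sd isT).
  rewrite /GRing.scale/= mulr1 addr0 f'0 subr0 => h.
  have : 0 < s^-1 * f' s.
    by move: h; rewrite ltr_norml => /andP[h1 h2]; lra.
  by rewrite pmulr_rgt0// invr_gt0.
pose s := Num.min (d / 2) (r / 2).
have s0 : 0 < s by rewrite lt_min !divr_gt0.
have sd : s < d by rewrite gt_min ltr_pdivrMr// mulr_natr mulr2n ltrDl d0.
have sr : s < r.
  by rewrite gt_min; apply/orP; right; rewrite ltr_pdivrMr// mulr_natr mulr2n ltrDl.
have dfs t : 0 <= t -> t <= s -> is_derive t (1 : R) f (f' t).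
  by move=> t0 ts; apply: df; rewrite ger0_norm// (le_lt_trans ts).
have cf : {within `[0, s], continuous f}.
  apply: derivable_within_continuous => t; rewrite in_itv/= => /andP[t0 ts].
  exact: (@ex_derive _ _ _ _ _ _ _ (dfs t t0 ts)).
have [t|c] := @MVT _ f f' 0 s s0 _ cf.
  by rewrite in_itv/= => /andP[/ltW t0 /ltW ts]; exact: dfs.
rewrite in_itv/= => /andP[c0 cs] e.
have : 0 < f s - f 0.
  by rewrite e subr0 mulr_gt0// pos// (lt_trans cs).
rewrite subr_gt0 ltNge => /negP; apply; apply: fmax.
by rewrite gtr0_norm.
Qed.

Lemma is_derive_add (f g : R -> R) s (a b : R) :
  is_derive s (1 : R) f a -> is_derive s (1 : R) g b ->
  is_derive s (1 : R) (fun t => f t + g t) (a + b).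
Proof. by move=> hf hg; exact: is_deriveD. Qed.

Lemma is_derive_translate (f : R -> R) s (l : R) :
  is_derive (0 : R) (1 : R) (fun t => f (s + t)) l -> is_derive s (1 : R) f l.
Proof.
move=> h; have sh := is_derive_shift s (1 : R) (- s).
have h' : is_derive (shift (- s) s) (1 : R) (fun t => f (s + t)) l.
  by rewrite /shift/= subrr.
have := @is_derive1_comp _ (fun t => f (s + t)) _ s _ _ h' sh.
rewrite mulr1; congr is_derive; apply/funext => t /=.
by rewrite addrC subrK.
Qed.

(* If Q(0) = 1, then Re Q + |z|^2 / (4 r^2) is larger at 0 than on the boundary
   of the square; its second derivatives in the two directions have positive
   sum since Re Q is harmonic, so there is no interior maximum either. *)
Lemma square_max_principle Q Q1 Q2 (r : R) : 0 < r -> pcontinuous Q ->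
  (forall z, `|Re z| < r -> `|Im z| < r -> holAt Q z (Q1 z)) ->
  (forall z, `|Re z| < r -> `|Im z| < r -> holAt Q1 z (Q2 z)) ->
  (forall z, `|Re z| <= r -> `|Im z| <= r -> `|Re z| = r \/ `|Im z| = r ->
    Q z = 0) ->
  Q 0 = 0.
Proof.
move=> r0 cQ hQ1 hQ2 bQ; apply/eqP/negPn/negP => Q0.
(* [lam] normalizes the value at 0 to 1. On the square |z|^2 is at most 2 r^2, so with this [del]
   the quadratic term is at most 1/2, and h stays below 1 wherever Q vanishes. *)
pose lam := (Q 0)^-1.
pose del : R := (4 * r ^+ 2)^-1.
have del0 : 0 < del by rewrite invr_gt0 mulr_gt0// exprn_gt0.
pose h (p : R * R) := Re (lam * Q (plane_pt p)) + del * (p.1 ^+ 2 + p.2 ^+ 2).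
have ch : continuous h.
  move=> p; apply: cvgD.
    have [c _] := pcontinuousM (pcontinuous_cst lam) cQ; exact: c.
  apply: cvgMr; apply: cvgD; rewrite expr2; under eq_fun do rewrite expr2.
    by apply: cvgM; exact: cvg_fst.
  by apply: cvgM; exact: cvg_snd.
pose K : set (R * R) := `[(- r), r]%classic `*` `[(- r), r]%classic.
have cK : compact K by apply: compact_setX; exact: segment_compact.
have KE p : K p <-> `|p.1| <= r /\ `|p.2| <= r.
  by rewrite /K /setX/= !in_itv/= -!ler_norml.
have K0 : K (0, 0) by rewrite KE/= normr0 ltW.
have Kn : K !=set0 by exists (0, 0).
have [[a0 b0] /set_mem Kp hmax] :=
  compact_EVT_max Kn cK (continuous_subspaceT ch).
have {}hmax p : K p -> h p <= h (a0, b0) by move=> Kq; apply: hmax; rewrite inE.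
have h0 : h (0, 0) = 1.
  by rewrite /h /plane_pt/= mulVf//= expr0n/= !addr0 mulr0 addr0.
have [ar br] := (KE _).1 Kp; rewrite /= in ar br.
have sq (u : R) : `|u| <= r -> u ^+ 2 <= r ^+ 2.
  by move=> ur; rewrite -real_normK ?num_real// ler_sqr ?nnegrE// ltW.
have nb : ~ (`|a0| = r \/ `|b0| = r).
  move=> hb; have := hmax _ K0; rewrite h0 /h bQ//= mulr0 add0r leNgt.
  move/negP; apply; apply: (@le_lt_trans _ _ (del * (2 * r ^+ 2))).
    by rewrite ler_pM2l// mulr_natl mulr2n lerD// sq.
  by rewrite /del invfM mulrACA mulVf ?expf_neq0 ?gt_eqF// mulr1; lra.
have {}ar : `|a0| < r.
  by rewrite lt_neqAle ar andbT; apply/eqP => e; apply: nb; left.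
have {}br : `|b0| < r.
  by rewrite lt_neqAle br andbT; apply/eqP => e; apply: nb; right.
pose z0 : R[i] := a0 +i* b0.
pose rho := Num.min (r - `|a0|) (r - `|b0|).
have rho0 : 0 < rho by rewrite lt_min !subr_gt0 ar br.
have near_a s : `|s| < rho -> `|a0 + s| < r.
  move=> hs; apply: le_lt_trans (ler_normD _ _) _.
  by rewrite addrC -ltrBrDr; apply: lt_le_trans hs _; rewrite ge_min lexx.
have near_b s : `|s| < rho -> `|b0 + s| < r.
  move=> hs; apply: le_lt_trans (ler_normD _ _) _.
  by rewrite addrC -ltrBrDr; apply: lt_le_trans hs _; rewrite ge_min lexx orbT.
have dsq (u0 s : R) : is_derive s (1 : R) (fun t => (u0 + t) ^+ 2)
    (2 * (u0 + s)).
  have hd := is_deriveX 2 (is_deriveD (is_derive_cst u0 s (1 : R))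
    (is_derive_id s (1 : R))).
  by apply: is_derive_eq hd _; rewrite /GRing.scale/= !fctE; ring.
have dlin (u0 s : R) : is_derive s (1 : R) (fun t => 2 * (u0 + t)) 2.
  have hd := is_deriveZ 2 (is_deriveD (is_derive_cst u0 s (1 : R))
    (is_derive_id s (1 : R))).
  by apply: is_derive_eq hd _; rewrite /GRing.scale/= add0r mulr1.
have e1R s : Re (z0 + 1 * s%:C) = a0 + s by rewrite !reimE/=; ring.
have e1I s : Im (z0 + 1 * s%:C) = b0 by rewrite !reimE/=; ring.
have eiR s : Re (z0 + 'i * s%:C) = a0 by rewrite !reimE/=; ring.
have eiI s : Im (z0 + 'i * s%:C) = b0 + s by rewrite !reimE/=; ring.
(* the restriction of h to the line through z0 in the direction e *)
have dir (e : R[i]) (u0 v0 : R) : (e = 1 /\ u0 = a0 /\ v0 = b0) \/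
    (e = 'i /\ u0 = b0 /\ v0 = a0) ->
  Re (lam * (e * e * Q2 z0)) + del * 2 <= 0.
  move=> he.
  have hz s : `|s| < rho -> `|Re (z0 + e * s%:C)| < r /\
      `|Im (z0 + e * s%:C)| < r.
    by move=> hs; case: he => -[-> _]; rewrite ?e1R ?e1I ?eiR ?eiI; split;
      rewrite ?near_a ?near_b.
  have dF mu F F1 (hF : forall z, `|Re z| < r -> `|Im z| < r ->
      holAt F z (F1 z)) s : `|s| < rho ->
      is_derive s (1 : R) (fun t => Re (mu * F (z0 + e * t%:C)))
        (Re (mu * (e * F1 (z0 + e * s%:C)))).
    move=> hs; have [h1 h2] := hz s hs.
    apply: is_derive_translate.
    have [H _] := cderivZ mu (hF _ h1 h2 e).
    by move: H; congr is_derive; apply/funext => t; congr (Re (_ * F _));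
      rewrite realCD; ring.
  pose f s := Re (lam * Q (z0 + e * s%:C)) + del * ((u0 + s) ^+ 2 + v0 ^+ 2).
  pose f' s := Re (lam * e * Q1 (z0 + e * s%:C)) + del * (2 * (u0 + s)).
  have fE s : f s = h (Re (z0 + e * s%:C), Im (z0 + e * s%:C)).
    rewrite /f /h /plane_pt; congr (Re (lam * Q _) + del * _).
      exact: complex_ext.
    case: he => -[-> [-> ->]]; first by rewrite e1R e1I.
    by rewrite eiR eiI addrC.
  have D1 s : `|s| < rho -> is_derive s (1 : R) f (f' s).
    move=> hs; have hA := dF lam Q Q1 hQ1 s hs.
    have hB : is_derive s (1 : R) (fun t => del * ((u0 + t) ^+ 2 + v0 ^+ 2))
        (del * (2 * (u0 + s))).
      have hd := is_deriveZ del
        (is_deriveD (dsq u0 s) (is_derive_cst (v0 ^+ 2) s (1 : R))).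
      by apply: is_derive_eq hd _; rewrite addr0.
    rewrite /f' -[lam * e * _]mulrA; exact: (is_derive_add hA hB).
  have D2 : is_derive (0 : R) (1 : R) f' (Re (lam * (e * e * Q2 z0)) + del * 2).
    have hA := dF (lam * e) Q1 Q2 hQ2 0; rewrite normr0 in hA.
    have {}hA := hA rho0; rewrite mulr0 addr0 in hA.
    have hB : is_derive (0 : R) (1 : R) (fun t => del * (2 * (u0 + t))) (del * 2).
      exact: (is_deriveZ del (dlin u0 0)).
    have -> : lam * (e * e * Q2 z0) = lam * e * (e * Q2 z0) by ring.
    exact: (is_derive_add hA hB).
  have D3 s : `|s| < rho -> f s <= f 0.
    move=> hs; have [h1 h2] := hz s hs.
    rewrite (fE s) [f 0]fE mulr0 addr0; apply: hmax; rewrite KE/=.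
    by split; apply: ltW.
  exact: (second_derivative_test rho0 D1 D2 D3).
(* As i^2 = -1, the contributions of Q2 in the two directions cancel, and the sum of the
   inequalities reads 4 [del] <= 0. *)
have d1 := dir 1 a0 b0 (or_introl (conj erefl (conj erefl erefl))).
have di := dir 'i b0 a0 (or_intror (conj erefl (conj erefl erefl))).
rewrite mul1r mul1r in d1.
have ii : ('i : R[i]) * 'i = -1 by apply: complex_ext; rewrite !reimE/=; ring.
rewrite ii mulN1r mulrN Re_opp in di.
by move: d1 di; move: (Re _) => w d1 di; lra.
Qed.

(* The product of the four rotations of F about c vanishes on the boundary of
   the square centred at c with one side on the real axis. *)
Lemma half_plane_unique sg F F1 F2 : sg * sg = 1 -> pcontinuous F ->
  (forall z, 0 < sg * Im z -> holAt F z (F1 z)) ->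
  (forall z, 0 < sg * Im z -> holAt F1 z (F2 z)) ->
  (forall z, Im z = 0 -> F z = 0) ->
  forall z, 0 < sg * Im z -> F z = 0.
Proof.
move=> sg1 cF hF1 hF2 F0 c c0; pose r := sg * Im c.
have rE : sg * r = Im c by rewrite /r mulrA sg1 mul1r.
have asg : `|sg| = 1.
  by apply/eqP; rewrite -sqrp_eq1// real_normK ?num_real// expr2 sg1.
have up (w z : R[i]) : `|Im (w * z)| < r -> 0 < sg * Im (c + w * z).
  move=> h; rewrite Im_add mulrDr -/r.
  have : `|sg * Im (w * z)| < r by rewrite normrM asg mul1r.
  by rewrite ltr_norml => /andP[h1 h2]; lra.
have low (w z : R[i]) : Im (w * z) = - sg * r -> F (c + w * z) = 0.
  by move=> h; apply: F0; rewrite Im_add h mulNr rE subrr.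
pose P w (G : R[i] -> R[i]) := fun z : R[i] => G (c + w * z).
have hP w (hw : forall z, `|Re z| < r -> `|Im z| < r -> `|Im (w * z)| < r) :
    (forall z, `|Re z| < r -> `|Im z| < r -> holAt (P w F) z (w * P w F1 z)) /\
    (forall z, `|Re z| < r -> `|Im z| < r ->
      holAt (fun z => w * P w F1 z) z (w * (w * P w F2 z))).
  split=> z h1 h2; first by apply: holAt_affine; apply: hF1; exact/up/hw.
  by apply: holAtZ; apply: holAt_affine; apply: hF2; exact/up/hw.
have prod2 A A1 A2 B B1 B2
  (a1 : forall z, `|Re z| < r -> `|Im z| < r -> holAt A z (A1 z))
  (a2 : forall z, `|Re z| < r -> `|Im z| < r -> holAt A1 z (A2 z))
  (b1 : forall z, `|Re z| < r -> `|Im z| < r -> holAt B z (B1 z))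
  (b2 : forall z, `|Re z| < r -> `|Im z| < r -> holAt B1 z (B2 z)) :
  (forall z, `|Re z| < r -> `|Im z| < r ->
    holAt (fun z => A z * B z) z (A1 z * B z + A z * B1 z)) /\
  (forall z, `|Re z| < r -> `|Im z| < r ->
    holAt (fun z => A1 z * B z + A z * B1 z) z
      (A2 z * B z + A1 z * B1 z + (A1 z * B1 z + A z * B2 z))).
  split=> z h1 h2; first by apply: holAtM; [exact: a1|exact: b1].
  by apply: holAtD; apply: holAtM; [exact: a2|exact: b1|exact: a1|exact: b2].
have im1 (z : R[i]) : Im (1 * z) = Im z by rewrite mul1r.
have imN1 (z : R[i]) : Im (-1 * z) = - Im z by rewrite mulN1r Im_opp.
have imi (z : R[i]) : Im ('i * z) = Re z by rewrite !reimE/=; ring.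
have imNi (z : R[i]) : Im (- 'i * z) = - Re z by rewrite mulNr Im_opp imi.
have [p1 p2] := hP 1 (fun z _ h => eq_ind_r (fun t => `|t| < r) h (im1 z)).
have [q1 q2] := hP (-1) (fun z _ h => eq_ind_r (fun t => `|t| < r)
  (eq_ind_r (fun t => t < r) h (normrN _)) (imN1 z)).
have [u1 u2] := hP 'i (fun z h _ => eq_ind_r (fun t => `|t| < r) h (imi z)).
have [v1 v2] := hP (- 'i) (fun z h _ => eq_ind_r (fun t => `|t| < r)
  (eq_ind_r (fun t => t < r) h (normrN _)) (imNi z)).
have [A1 A2] := prod2 _ _ _ _ _ _ p1 p2 q1 q2.
have [B1 B2] := prod2 _ _ _ _ _ _ u1 u2 v1 v2.
have [Q1 Q2] := prod2 _ _ _ _ _ _ A1 A2 B1 B2.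
have cP w : pcontinuous (P w F) by exact: pcontinuous_affine.
have cQ := pcontinuousM (pcontinuousM (cP 1) (cP (-1)))
  (pcontinuousM (cP 'i) (cP (- 'i))).
have := square_max_principle c0 cQ Q1 Q2.
(* At the centre all four rotated factors equal F c, so the product is its fourth power. *)
rewrite {5 6 7 8}/P !mulr0 addr0 => H.
have sgc : sg = 1 \/ sg = -1.
  have : (sg == 1) || (sg == -1) by rewrite -sqrf_eq1 expr2 sg1.
  by case/orP => /eqP ->; [left|right].
have cases (t : R) : `|t| = r -> t = - sg * r \/ t = sg * r.
  move=> tr; have : (t == r) || (t == - r).
    by rewrite -eqf_sqr -(real_normK (num_real t)) tr.
  by case: sgc => ->; case/orP => /eqP ->; rewrite ?opprK ?mulN1r ?mul1r;
    [right|left|left|right].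
have {H} /eqP : F c * F c * (F c * F c) = 0.
  (* Each side of the square is carried onto the real axis by exactly one of the four rotations, and
     that factor vanishes. *)
  apply: H => z _ _ [] /cases [] h.
  - by rewrite [P 'i F z]low ?imi// mul0r mulr0.
  - by rewrite [P (- 'i) F z]low ?imNi ?h ?mulNr// !mulr0.
  - by rewrite [P 1 F z]low ?im1// !mul0r.
  - by rewrite [P (-1) F z]low ?imN1 ?h ?mulNr// mulr0 mul0r.
by rewrite !mulf_eq0 !orbb => /eqP.
Qed.

End BoundaryUniqueness.

(** * Means along horizontal lines *)

Section HalfPlaneFourier.
Variable R : realType.
Implicit Types (F G : R[i] -> R[i]) (a b c l z w : R[i]) (x y s t sg : R).

Local Notation Re := complex.Re.
Local Notation Im := complex.Im.
Local Notation "z ^*" := (Num.conj z) : complex_scope.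
Local Notation normc := (@Normc.normc R).
Local Notation mu := (@lebesgue_measure R).
Local Notation circle := (@circle R).

Lemma continuous_pair_bounded (u : R * R -> R) (a1 b1 a2 b2 : R) :
  continuous u -> exists2 B, 0 <= B & forall x y,
    a1 <= x <= b1 -> a2 <= y <= b2 -> `|u (x, y)| <= B.
Proof.
move=> cu; pose K : set (R * R) := `[a1, b1]%classic `*` `[a2, b2]%classic.
have cK : compact K by apply: compact_setX; exact: segment_compact.
have cn : continuous (fun p => `|u p|).
  by move=> p; apply: cvg_norm; exact: cu.
have [Kn|Kn] := pselect (K !=set0); last first.
  exists 0 => // x y hx hy; case: Kn; exists (x, y).
  by rewrite /K/setX/= !in_itv.
have [c _ hc] := compact_EVT_max Kn cK (continuous_subspaceT cn).
exists `|u c| => // x y hx hy; apply: hc; rewrite inE /K/setX/= !in_itv/=.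
by split.
Qed.

Lemma continuous_fst_slice (u : R * R -> R) t :
  continuous u -> continuous (fun x => u (x, t)).
Proof.
move=> cu x; apply: (@continuous_comp _ _ _ (fun x : R => (x, t)) u).
  exact: (cvg_pair cvg_id (cvg_cst t)).
exact: cu.
Qed.

Lemma continuous_snd_slice (u : R * R -> R) x :
  continuous u -> continuous (fun t => u (x, t)).
Proof.
move=> cu t; apply: (@continuous_comp _ _ _ (fun t : R => (x, t)) u).
  exact: (cvg_pair (cvg_cst x) cvg_id).
exact: cu.
Qed.

Lemma integral_constant (u w : R * R -> R) : continuous u -> continuous w ->
  (forall x y, 0 < y -> is_derive y (1 : R) (fun t => u (x, t)) (w (x, y))) ->
  (forall y, 0 < y -> \int[mu]_(x in circle) w (x, y) = 0) ->
  forall y, 0 <= y ->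
    \int[mu]_(x in circle) u (x, y) = \int[mu]_(x in circle) u (x, 0).
Proof.
move=> cu cw du w0.
pose f t x := u (x, t).
pose J t := \int[mu]_(x in circle) f t x.
have intf t : mu.-integrable circle (EFin \o f t).
  exact/continuous_intR/continuous_fst_slice.
have intc (B : R) : mu.-integrable circle (EFin \o (fun=> B)).
  by apply: continuous_intR => x; exact: cvg_cst.
have dJ y : 0 < y -> is_derive y (1 : R) J 0.
  move=> y0; have [B B0 hB] := continuous_pair_bounded 0 (2 * pi) (y / 2) (2 * y) cw.
  (* The interval around y stays away from 0, since the derivative is given only at positive
     heights. *)
  have Iy : `]y / 2, (2 * y)[%classic y by rewrite /= in_itv/=; apply/andP; split; lra.
  have pos t : `]y / 2, (2 * y)[%classic t -> 0 < t /\ y / 2 <= t <= 2 * y.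
    by rewrite /= in_itv/= => /andP[h1 h2]; split; [lra|rewrite !ltW].
  have df t x : `]y / 2, (2 * y)[%classic t -> circle x -> derivable (f^~ x) t 1.
    by move=> /pos[t0 _] _; exact: (@ex_derive _ _ _ _ _ _ _ (du x t t0)).
  have p1E t x : 0 < t -> partial1of2 f t x = w (x, t).
    by move=> t0; rewrite partial1of2E (@derive_val _ _ _ _ _ _ _ (du x t t0)).
  have ub t x : `]y / 2, (2 * y)[%classic t -> circle x ->
      `|partial1of2 f t x| <= B.
    move=> /pos[t0 ht]; rewrite /Defs.circle/= in_itv/= => hx.
    by rewrite p1E// hB.
  have mc := @measurable_circle R.
  have D := derivable_under_integral mc Iy (fun t _ => intf t) df (fun=> B0)
    (intc B) ub.
  have V := differentiation_under_integral mc Iy (fun t _ => intf t) df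
    (fun=> B0) (intc B) ub.
  split; first exact: D.
  rewrite -derive1E V -(w0 y y0).
  by apply: eq_Rintegral => x _; rewrite p1E.
move=> y; rewrite le_eqVlt => /predU1P[<-//|y0].
(* Height 0 is reached by continuity. The interval from -1 to y + 1 makes 0 an interior point, which
   is possible as u is continuous on the whole plane. *)
have [B B0 hB] := continuous_pair_bounded 0 (2 * pi) (-1) (y + 1) cu.
have mc := @measurable_circle R.
have cJ : {in `](-1), (y + 1)[%classic, continuous J}.
  apply: (continuity_under_integral mc (fun t _ => intf t) _ (intc B)).
    by apply: aeW => x _ t _; exact: continuous_snd_slice.
  move=> t; rewrite /= in_itv/= => /andP[/ltW h1 /ltW h2]; apply: aeW => x.
  by rewrite /Defs.circle/= in_itv/= => hx; apply: hB => //; rewrite h1 h2.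
have wJ : {within `[0, y], continuous J}.
  apply: continuous_in_subspaceT => t; rewrite inE/= in_itv/= => /andP[t0 ty].
  by apply: cJ; rewrite inE/= in_itv/=; apply/andP; split; lra.
have dJ' t : t \in `]0, y[ -> is_derive t (1 : R) J ((fun=> 0) t).
  by rewrite in_itv/= => /andP[t0 _]; exact: dJ.
have [c _] := MVT_segment (ltW y0) dJ' wJ.
by rewrite mul0r => /eqP; rewrite subr_eq0 => /eqP.
Qed.

(** By the Cauchy-Riemann equations the derivative in the height y is i sg times the derivative in
    x, whose mean over a period is zero. *)
Lemma circle_mean_height sg G G1 : sg * sg = 1 ->
  pcontinuous G -> pcontinuous G1 ->
  (forall z, 0 < sg * Im z -> holAt G z (G1 z)) ->
  (forall z, 0 < sg * Im z -> G (z + (2 * pi)%:C) = G z) ->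
  forall y, 0 <= y -> circle_mean (fun x => G (x +i* (sg * y))) =
    circle_mean (fun x => G x%:C).
Proof.
move=> sg1 cG cG1 hG pG.
pose m y : R -> R[i] := fun x => x +i* (sg * y).
have up y x : 0 < y -> 0 < sg * Im (m y x).
  by move=> y0; rewrite /m mulrA sg1 mul1r.
pose H z := 'i * sg%:C * G1 z.
have cH : pcontinuous H by exact: pcontinuousM (pcontinuous_cst _) cG1.
pose V (p : R * R) : R[i] := p.1 +i* (sg * p.2).
have cV F : pcontinuous F -> continuous (fun p => Re (F (V p))) /\
    continuous (fun p => Im (F (V p))).
  move=> [c1 c2].
  have cP : continuous (fun p : R * R => (p.1, sg * p.2)).
    move=> p; have q1 : (fun q : R * R => q.1) @ p --> p.1 by exact: cvg_fst.
    have q2 : (fun q : R * R => sg * q.2) @ p --> sg * p.2.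
      by apply: cvgMr; exact: cvg_snd.
    exact: (cvg_pair q1 q2).
  split=> p.
    apply: (@continuous_comp _ _ _ (fun p : R * R => (p.1, sg * p.2))
      (fun p => Re (F (plane_pt p)))); [exact: cP|exact: c1].
  apply: (@continuous_comp _ _ _ (fun p : R * R => (p.1, sg * p.2))
    (fun p => Im (F (plane_pt p)))); [exact: cP|exact: c2].
have cG1s y : ccontinuous (fun x => G1 (m y x)).
  have [c1 c2] := cV _ cG1.
  by split => x; 
    [exact: (@continuous_fst_slice (fun p => Re (G1 (V p))) y c1 x)|
     exact: (@continuous_fst_slice (fun p => Im (G1 (V p))) y c2 x)].
have dx y x : 0 < y -> cderiv (fun x => G (m y x)) x (G1 (m y x)).
  move=> y0; have := hG _ (up y x y0) 1; rewrite mul1r => -[h1 h2].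
  have e s : m y (x + s) = m y x + 1 * s%:C.
    by apply: complex_ext; rewrite /m !reimE/=; ring.
  split; apply: is_derive_translate.
    by move: h1; congr is_derive; apply/funext => s; rewrite e.
  by move: h2; congr is_derive; apply/funext => s; rewrite e.
have dy y x : 0 < y -> cderiv (fun t => G (V (x, t))) y (H (V (x, y))).
  move=> y0; have [h1 h2] := hG _ (up y x y0) ('i * sg%:C).
  have e s : V (x, y + s) = m y x + 'i * sg%:C * s%:C.
    by apply: complex_ext; rewrite /m /V !reimE/=; ring.
  split; apply: is_derive_translate.
    by move: h1; congr is_derive; apply/funext => s; rewrite e.
  by move: h2; congr is_derive; apply/funext => s; rewrite e.
have H0 y : 0 < y -> circle_mean (fun x => H (V (x, y))) = 0.
  move=> y0; rewrite circle_meanZ; last exact: ccontinuous_cintegrable (cG1s y).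
  rewrite (circle_mean_deriv (fun x => dx y x y0) (cG1s y)).
  have -> : m y (2 * pi) = m y 0 + (2 * pi)%:C.
    by apply: complex_ext; rewrite /m !reimE; ring.
  by rewrite pG ?up// subrr !mulr0.
have p0 : (2 * pi : R)^-1 != 0 by rewrite invr_neq0// mulf_neq0// gt_eqF// pi_gt0.
have ReIm0 y : 0 < y -> \int[mu]_(x in circle) Re (H (V (x, y))) = 0 /\
    \int[mu]_(x in circle) Im (H (V (x, y))) = 0.
  move=> /H0; rewrite /circle_mean => e.
  have := congr1 (@complex.Re R) e; have := congr1 (@complex.Im R) e.
  rewrite !reimE !mul0r subr0 addr0 => /eqP; rewrite mulf_eq0 (negbTE p0) => /eqP ->.
  by move=> /eqP; rewrite mulf_eq0 (negbTE p0) => /eqP ->.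
have [g1 g2] := cV _ cG; have [k1 k2] := cV _ cH.
move=> y y0.
have mE x : V (x, 0) = x%:C by apply: complex_ext; rewrite /V !reimE ?mulr0.
transitivity (circle_mean (fun x => G (V (x, 0)))); last first.
  by apply: circle_mean_ext => x _; rewrite mE.
rewrite /circle_mean; congr (_ * (_ +i* _)).
  apply: (@integral_constant (fun p => Re (G (V p))) (fun p => Re (H (V p)))) => //.
    by move=> x t t0; have [] := dy t x t0.
  by move=> t /ReIm0[].
apply: (@integral_constant (fun p => Im (G (V p))) (fun p => Im (H (V p)))) => //.
  by move=> x t t0; have [] := dy t x t0.
by move=> t /ReIm0[].
Qed.

End HalfPlaneFourier.

(** * Fourier coefficients of boundary values *)

Section BoundaryCoefficients.
Variable R : realType.
Implicit Types (F G : R[i] -> R[i]) (a b c l z w u : R[i]) (x y s t sg : R).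

Local Notation Re := complex.Re.
Local Notation Im := complex.Im.
Local Notation "z ^*" := (Num.conj z) : complex_scope.

Lemma pcontinuous_line G t : pcontinuous G -> ccontinuous (fun x => G (x +i* t)).
Proof.
move=> [c1 c2]; split => x.
  exact: (@continuous_fst_slice _ (fun p => Re (G (plane_pt p))) t c1 x).
exact: (@continuous_fst_slice _ (fun p => Im (G (plane_pt p))) t c2 x).
Qed.

(** The coefficient is the mean of F(z) e^(-imz) on any horizontal line of the half plane. The sign
    condition on m keeps the exponential bounded by 1, so as F tends to 1 only the mean of the
    exponential survives. *)
Lemma half_plane_fourier sg F F1 F2 (m : int) : sg * sg = 1 ->
  pcontinuous (fun z => F (clamp sg z)) ->
  pcontinuous (fun z => F1 (clamp sg z)) ->
  (forall z, 0 < sg * Im z -> holAt F z (F1 z)) ->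
  (forall z, 0 < sg * Im z -> holAt F1 z (F2 z)) ->
  cperiodic (fun x => F x%:C) ->
  (forall d, 0 < d -> exists Y, forall z, Y <= sg * Im z ->
    sqn (F z - 1) <= d ^+ 2) ->
  sg * m%:~R <= 0 -> bracket (mode m) (fun x => F x%:C) = (m == 0)%:R.
Proof.
move=> sg1 cF cF1 hF hF1 pF decay m0.
pose Fc z := F (clamp sg z); pose Fc1 z := F1 (clamp sg z).
have FcE z : 0 <= sg * Im z -> Fc z = F z by move=> h; rewrite /Fc clamp_id.
have Fc1E z : 0 <= sg * Im z -> Fc1 z = F1 z by move=> h; rewrite /Fc1 clamp_id.
have hFc z : 0 < sg * Im z -> holAt Fc z (F1 z).
  by move=> h; apply: holAt_clamp => //; exact: hF.
pose P : R[i] := (2 * pi)%:C.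
have up z : 0 < sg * Im z -> 0 < sg * Im (P + 1 * z).
  by rewrite mul1r Im_add Im_real add0r.
have pFc z : 0 < sg * Im z -> Fc (z + P) = Fc z.
  move=> hz; apply/eqP; rewrite -subr_eq0; apply/eqP.
  pose W z := Fc (P + 1 * z) + -1 * Fc z.
  have <- : W z = Fc (z + P) - Fc z by rewrite /W mul1r mulN1r [P + z]addrC.
  apply: (@half_plane_unique _ sg W (fun z => 1 * F1 (P + 1 * z) + -1 * F1 z)
    (fun z => 1 * (1 * F2 (P + 1 * z)) + -1 * F2 z) sg1) => //.
  - apply: pcontinuousD; first exact: pcontinuous_affine.
    by apply: pcontinuousM => //; exact: pcontinuous_cst.
  - move=> v hv; apply: holAtD; last by apply: holAtZ; exact: hFc.
    by apply: holAt_affine; apply: hFc; exact: up.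
  - move=> v hv; apply: holAtD; last by apply: holAtZ; exact: hF1.
    by apply: holAtZ; apply: holAt_affine; apply: hF1; exact: up.
  - move=> v hv; have -> : v = (Re v)%:C by apply: complex_ext; rewrite ?reimE.
    rewrite /W mul1r mulN1r -realCD !FcE ?Im_real ?mulr0// [2 * pi + _]addrC.
    by rewrite pF subrr.
(* [E] continues the conjugate of [mode m] analytically; its modulus is e^(m Im z). *)
pose k : R[i] := - ('i * m%:~R%:C).
pose E z := cexp (k * z + 0).
pose G z := Fc z * E z.
pose G1 z := Fc1 z * E z + Fc z * (k * E z).
have cE : pcontinuous E.
  apply: (@pcontinuous_comp _ (@cexp R) (fun z => k * z + 0)).
    exact: pcontinuous_cexp.
  apply: pcontinuousD; last exact: pcontinuous_cst.
  by apply: pcontinuousM; [exact: pcontinuous_cst|exact: pcontinuous_id].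
have cG : pcontinuous G by exact: pcontinuousM.
have cG1 : pcontinuous G1.
  apply: pcontinuousD; apply: pcontinuousM => //.
  by apply: pcontinuousM => //; exact: pcontinuous_cst.
have hG z : 0 < sg * Im z -> holAt G z (G1 z).
  move=> hz; rewrite /G1 Fc1E; last exact: ltW.
  by apply: holAtM; [exact: hFc|exact: holAt_cexp].
have EE x y : E (x +i* y) = (expR (m%:~R * y))%:C * (mode m x)^*.
  rewrite /E (_ : k * _ + 0 = (m%:~R * y)%:C + 'i * (- (m%:~R * x))%:C); last first.
    by apply: complex_ext; rewrite /k !reimE/=; ring.
  rewrite cexpD cexp_i cisN /mode; congr (_ * _).
  by rewrite /cexp Re_real Im_real cis0 mulr1.
have pG z : 0 < sg * Im z -> G (z + P) = G z.
  move=> hz; rewrite /G pFc//; congr (_ * _).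
  case: z hz => a b _; rewrite (_ : _ + P = (a + 2 * pi) +i* b); last first.
    by apply: complex_ext; rewrite /P !reimE ?addr0.
  rewrite !EE /mode mulrDr cisD cis_int2pi mulr1.
  by [].
have mean y : 0 <= y -> circle_mean (fun x => G (x +i* (sg * y))) =
    bracket (mode m) (fun x => F x%:C).
  move=> y0; rewrite (circle_mean_height sg1 cG cG1 hG pG y0).
  apply: circle_mean_ext => x _; rewrite /G FcE ?Im_real ?mulr0// mulrC.
  by rewrite -[x%:C]/(x +i* 0) EE mulr0 expR0 mul1r.
set b := bracket _ _; set e : R[i] := (m == 0)%:R.
have small d : 0 < d -> `|Re (b - e)| <= d /\ `|Im (b - e)| <= d.
  move=> d0; have [Y hY] := decay _ d0.
  pose y := Num.max Y 0.
  have y0 : 0 <= y by rewrite le_max lexx orbT.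
  pose q := expR (m%:~R * (sg * y)).
  have q1 : q <= 1.
    rewrite /q -[leRHS]expR0 ler_expR mulrA [_ * sg]mulrC.
    by rewrite mulr_le0_ge0.
  have hq x : G (x +i* (sg * y)) - q%:C * (mode m x)^* =
      (F (x +i* (sg * y)) - 1) * (q%:C * (mode m x)^*).
    have h : 0 <= sg * Im (x +i* (sg * y)) by rewrite mulrA sg1 mul1r.
    by rewrite /G EE FcE// mulrBl mul1r.
  have cc : ccontinuous (fun x => q%:C * (mode m x)^*).
    apply: ccontinuousM; first exact: ccontinuous_cst.
    rewrite (_ : (fun x => _) = mode (- m)); first exact: ccontinuous_mode.
    by apply/funext => x; rewrite /mode mulrNz mulNr cisN.
  have cGl := pcontinuous_line (sg * y) cG.
  have i1 := ccontinuous_cintegrable cGl.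
  have i2 := ccontinuous_cintegrable cc.
  (* For m = 0 the weight q is 1, and otherwise the conjugate mode has mean zero, so replacing F by
     1 gives exactly e at every height. *)
  have me : circle_mean (fun x => q%:C * (mode m x)^*) = e.
    rewrite circle_meanZ; last first.
      by apply: cintegrable_conj; exact: ccontinuous_cintegrable (ccontinuous_mode _ _).
    rewrite circle_mean_conj; last first.
      exact: ccontinuous_cintegrable (ccontinuous_mode _ _).
    rewrite circle_mean_cis rmorph_nat /e; have [m00|_] := eqVneq m 0.
      by rewrite mulr1 /q m00 mul0r expR0.
    by rewrite mulr0.
  have -> : b - e = circle_mean (fun x => G (x +i* (sg * y)) -
      q%:C * (mode m x)^*).
    rewrite /b -(mean y y0) -me -mulN1r -circle_meanZ// -circle_meanD//; last first.
      exact: cintegrableZ.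
    by apply: circle_mean_ext => x _; rewrite mulN1r.
  apply: circle_mean_bound => [|x _|]; last exact: ltW.
    under eq_fun do rewrite -mulN1r.
    by apply: cintegrableD => //; exact: cintegrableZ.
  rewrite hq !sqnM.
  have -> : sqn (mode m x)^* = 1 by rewrite -cisN sqn_cis.
  have hh : sqn (F (x +i* (sg * y)) - 1) <= d ^+ 2.
    by apply: hY; rewrite mulrA sg1 mul1r le_max lexx.
  apply: le_trans hh; rewrite mulr1 ler_piMr ?sqn_ge0//.
  by rewrite /sqn Re_real Im_real expr0n addr0 expr_le1// expR_ge0.
have zero (r : R) : (forall d, 0 < d -> `|r| <= d) -> r = 0.
  move=> h; apply/eqP; rewrite -normr_le0; apply/ler_addgt0Pl => d d0.
  by rewrite addr0 h.
apply/eqP; rewrite -subr_eq0; apply/eqP; apply: complex_ext.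
  by apply: zero => d /small[].
by apply: zero => d /small[].
Qed.

Lemma extension_fourier (eps alpha sg t : R) u (psi : R -> R[i])
    (F : R[i]^o -> R[i]^o) (m : int) :
  0 < eps -> 0 < alpha -> sg * sg = 1 ->
  half_plane_extension eps sg alpha u t psi F ->
  cperiodic (fun x => psi x / plane_wave eps u x%:C t) ->
  sg * m%:~R <= 0 ->
  bracket (mode m) (fun x => psi x / plane_wave eps u x%:C t) = (m == 0)%:R.
Proof.
move=> eps0 alpha0 sg1 [Fpsi [G [G0 hG]] [rem [K [Y hrem]]]] per m0.
pose A : R[i] := - ('i / eps%:C * u); pose B : R[i] := 'i / eps%:C * (u ^+ 2 * t%:C).
pose E z := cexp (A * z + B).
have EE z : E z = (plane_wave eps u z t)^-1.
  by rewrite /E /plane_wave -cexpN; congr cexp; rewrite /A /B; ring.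
have cE : pcontinuous E.
  apply: (@pcontinuous_comp _ (@cexp R) (fun z => A * z + B)).
    exact: pcontinuous_cexp.
  apply: pcontinuousD; last exact: pcontinuous_cst.
  by apply: pcontinuousM; [exact: pcontinuous_cst|exact: pcontinuous_id].
have ccl : pcontinuous (clamp sg).
  apply: (@within_continuous_pcontinuous _ sg id sg1).
  by apply: continuous_subspaceT => z; exact: cvg_id.
have cEc : pcontinuous (fun z => E (clamp sg z)) by exact: pcontinuous_comp.
have cGc k : pcontinuous (fun z => G k (clamp sg z)).
  by apply: within_continuous_pcontinuous => //; have [] := hG k.
have hGk k z : 0 < sg * Im z -> holAt (G k) z (G k.+1 z).
  by move=> hz; apply: is_derive_holAt; have [_] := hG k; apply.
have hE z : holAt E z (A * E z) by exact: holAt_cexp.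
pose P z := G 0%N z * E z.
pose P1 z := G 1%N z * E z + G 0%N z * (A * E z).
pose P2 z := (G 2%N z * E z + G 1%N z * (A * E z)) +
   (G 1%N z * (A * E z) + G 0%N z * (A * (A * E z))).
have PE x : P x%:C = psi x / plane_wave eps u x%:C t.
  by rewrite /P EE G0 Fpsi.
have -> : (fun x => psi x / plane_wave eps u x%:C t) = (fun x => P x%:C).
  by apply/funext => x; rewrite PE.
apply: (@half_plane_fourier sg P P1 P2) => //.
- exact: pcontinuousM.
- apply: pcontinuousD; apply: pcontinuousM => //.
  by apply: pcontinuousM => //; exact: pcontinuous_cst.
- by move=> z hz; apply: holAtM; [exact: hGk|exact: hE].
- move=> z hz; apply: holAtD; apply: holAtM; try exact: hGk; try exact: hE.
  exact: holAtZ.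
- by move=> x; rewrite !PE per.
(* Above this height s = alpha |Im z| / eps is at least |K| / d, and then |K| e^(-s) <= d because
   e^s >= s. *)
- move=> d d0; pose Y' := Num.max Y (`|K| / d * eps / alpha).
  exists Y' => z hz.
  have [hY hK] : Y <= sg * Im z /\ `|K| / d * eps / alpha <= sg * Im z.
    by split; apply: le_trans hz; rewrite le_max lexx ?orbT.
  have [FE hr] := hrem z hY.
  have -> : P z - 1 = rem z.
    rewrite /P EE G0 FE mulfK; first by ring.
    exact: cexp_neq0.
  rewrite normcE_norm lecR in hr.
  rewrite -normc_le; last exact: ltW.
  apply: (le_trans hr).
  have asg : `|Im z| = `|sg * Im z|.
    rewrite normrM; suff -> : `|sg| = 1 by rewrite mul1r.
    by apply/eqP; rewrite -sqrp_eq1// real_normK ?num_real// expr2 sg1.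
  have hs : `|K| / d <= alpha * `|Im z| / eps.
    have := le_trans hK (ler_norm _); rewrite ler_pdivrMr// => hK'.
    by rewrite asg ler_pdivlMr// [alpha * _]mulrC.
  move: hs; set s := alpha * _ / eps => hs.
  apply: (@le_trans _ _ (`|K| * expR (- s))).
    by rewrite ler_wpM2r ?expR_ge0// ler_norm.
  rewrite expRN ler_pdivrMr ?expR_gt0//.
  apply: (@le_trans _ _ (d * s)); first by rewrite mulrC -ler_pdivrMr.
  rewrite ler_pM2l//; apply: le_trans (expR_ge1Dx s).
  by rewrite lerDr.
Qed.

End BoundaryCoefficients.

(** * The Baker-Akhiezer function *)

Section BakerAkhiezer.
Variable R : realType.
Implicit Types (f g : R -> R[i]) (u : R[i]) (x t : R).

Local Notation Re := complex.Re.
Local Notation Im := complex.Im.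

Lemma smooth_reim_derive f : smooth f ->
  (forall x, cderiv f x (reim_derive f x)) /\ forall k, Cn k (reim_derive f).
Proof.
move=> sf; pose D j : R -> R[i] := fun x =>
  derive1n j (fun y => Re (f y)) x +i* derive1n j (fun y => Im (f y)) x.
have dD j x : cderiv (D j) x (D j.+1 x).
  have [h1 h2] := sf j x; split.
    by split; [exact: h1|rewrite -derive1E].
  by split; [exact: h2|rewrite -derive1E].
have D0 : D 0%N = f by apply/funext => x; apply: complex_ext.
have D1 : D 1%N = reim_derive f by [].
split; first by move=> x; rewrite -D1 -{1}D0.
move=> k; rewrite -D1; move: 1%N; elim: k => [|k IH] j.
  exact: cderiv_continuous (dD j).
by exists (D j.+1); split => [x|]; [exact: dD|exact: IH].
Qed.

Lemma cvg_fourier_sum f x : Cn 2 f -> cperiodic f ->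
  (forall n : nat, bracket (mode (Negz n)) f = 0) ->
  (fun N => fourier_sum f N x : R[i]^o) @ \oo --> (f x : R[i]^o).
Proof.
move=> hf pf f0; have [B B0 hB] := fourier_sum_uniform hf pf f0.
apply/cvgrPdist_lt => e e0.
have eE : e = (Re e)%:C.
  by apply: complex_ext => //; move: e0; rewrite ltcE => /andP[/eqP].
have d0 : 0 < Re e by move: e0; rewrite ltcE => /andP[].
have q0 : 0 <= B / Re e by rewrite divr_ge0// ltW.
exists (Num.bound (B / Re e)).+2 => // n /= hn.
have [k hk] : exists k, n = k.+2 by case: n hn => [//|[//|k]] _; exists k.
rewrite hk !ltnS in hn *.
rewrite eE normc_ltE; apply: le_lt_trans (hB x k) _.
rewrite ltr_pdivrMr ?ltr0n// mulrC -ltr_pdivrMr//.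
by apply: lt_trans (archi_boundP q0) _; rewrite ltr_nat.
Qed.

(** The zeros and poles of T are real. *)
Lemma T_up_neq0 n (s_up : 'rV[R]_n.+1) (s_dn : 'rV[R]_n) u : Im u != 0 ->
  T_up s_up s_dn u != 0.
Proof.
move=> u0; have h (s : R) : u - s%:C != 0.
  by apply: contra_neq u0 => /(congr1 (@complex.Im R)); rewrite !reimE oppr0 addr0.
by rewrite /T_up mulf_neq0 ?invr_neq0//; apply/prodf_neq0 => i _; exact: h.
Qed.

(** An exhibited solution f rules out the default of [xget]; the chosen solution may differ from f,
    but not in its coefficients. *)
Lemma resolvent_bracket eps (v : R -> R) u g f l h : Im u != 0 ->
  L2_circle g -> L_bullet eps v f l -> L2_eq (fun x => u * f x - l x) g ->
  bracket (ket h) (resolvent eps v u g) = bracket (ket h) f.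
Proof.
move=> u0 hg L e; rewrite /resolvent; case: xgetP => [f0 _ [l0 [L0 e0]]|H].
  by apply: (resolvent_unique u0 (L2_ket _ h) hg L0 e0 L e).
by case: (H f); exists l.
Qed.

End BakerAkhiezer.

Theorem proposition4p2p1 (R : realType) (eps : R) (n : nat)
  (s_up : 'rV[R]_n.+1) (s_dn chi : 'rV[R]_n)
  (Psi_p Psi_m : R[i] -> R -> R -> R[i])
  (eps_gt0 : 0 < eps)
  (s_interlaced : interlaced s_up s_dn)
  (v_periodic : forall x t : R,
    multi_phase eps s_up s_dn chi (x + 2 * pi) t =
    multi_phase eps s_up s_dn chi x t)
  (Psi_DK : DK_functions eps s_up s_dn chi Psi_p Psi_m) :
  forall (u : R[i]) (t x : R), complex.Im u != 0 ->
    cvgn (BA_partial_sum eps (fun y => multi_phase eps s_up s_dn chi y t)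
            u (cis x)) /\
    Phi_BA eps (fun y => multi_phase eps s_up s_dn chi y t) u (cis x) =
      T_up s_up s_dn u * periodic_part eps Psi_p u x t.
Proof.
move=> u t x u0.
case: Psi_DK => smo [alpha alpha0 /(_ u t u0)[[Fp extp] [Fm extm]]].
move=> /(_ v_periodic) per eqn.
have [smp smm] := smo u t u0.
set v := fun y => multi_phase eps s_up s_dn chi y t.
set T := T_up s_up s_dn u; have T0 : T != 0 by exact: T_up_neq0.
pose pp y := Psi_p u y t / plane_wave eps u y%:C t.
pose pm y := Psi_m u y t / plane_wave eps u y%:C t.
have ppP : cperiodic pp by move=> y; have [] := per u y t u0.
have pmP : cperiodic pm by move=> y; have [] := per u y t u0.
have fp (m : int) : (m <= 0)%R -> bracket (mode m) pp = (m == 0)%:R.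
  move=> m0; apply: (extension_fourier eps_gt0 alpha0 _ extp ppP).
    by rewrite mulr1.
  by rewrite mul1r lerz0.
have fm (m : int) : (0 <= m)%R -> bracket (mode m) pm = (m == 0)%:R.
  move=> m0; apply: (extension_fourier eps_gt0 alpha0 _ extm pmP).
    by rewrite mulrNN mulr1.
  by rewrite mulN1r oppr_le0 ler0z.
pose A : R[i] := - ('i / eps%:C * u).
pose B : R[i] := 'i / eps%:C * (u ^+ 2 * t%:C).
pose E y := cexp (A * y%:C + B).
have EE y : (plane_wave eps u y%:C t)^-1 = E y.
  by rewrite /E /plane_wave -cexpN; congr cexp; rewrite /A /B; ring.
have [dpsi cpsi] := smooth_reim_derive smp.
have [dpsim cpsim] := smooth_reim_derive smm.
have Cpsi k : Cn k (fun y => Psi_p u y t).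
  by apply: Cn_pred; exists (reim_derive (fun y => Psi_p u y t)).
have Cpsim k : Cn k (fun y => Psi_m u y t).
  by apply: Cn_pred; exists (reim_derive (fun y => Psi_m u y t)).
have CE k : Cn k E by exact: Cn_cexp.
pose psi' := reim_derive (fun y => Psi_p u y t).
pose D y := psi' y * E y + Psi_p u y t * (A * E y).
have ppE : pp = (fun y => Psi_p u y t * E y).
  by apply/funext => y; rewrite /pp EE.
have pmE : pm = (fun y => Psi_m u y t * E y).
  by apply/funext => y; rewrite /pm EE.
have Cpp k : Cn k pp by rewrite ppE; apply: CnM.
have Cpm k : Cn k pm by rewrite pmE; apply: CnM.
have CD k : Cn k D.
  by apply: CnD; apply: CnM => //; apply: CnM => //; exact: Cn_cst.
have dpp y : cderiv pp y (D y).
  by rewrite ppE; apply: cderivM; [exact: dpsi|exact: cderiv_cexp].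
have DP : cperiodic D by exact: cperiodic_deriv dpp ppP.
have fD m : bracket (mode m) D = 'i * m%:~R%:C * bracket (mode m) pp.
  exact: bracket_mode_deriv dpp (Cn_continuous (CD 0%N)) ppP.
have epsC : eps%:C != 0 by rewrite eq_complex/= eqxx andbT gt_eqF.
(* The derivative falling on the inverse plane wave produces the factor A, and i eps A = u accounts
   for the term u pp. *)
have vpp y : (v y)%:C * pp y = u * pp y - 'i * eps%:C * D y - T^-1 * pm y.
  have i2 : 'i * 'i = -1 :> R[i] by apply: complex_ext; rewrite !reimE/=; ring.
  have iA : 'i * eps%:C * A = u.
    rewrite /A mulrN mulrA [_ * ('i / _)]mulrACA i2 mulfV// mulr1 mulN1r opprK.
    by [].
  have iV : 'i^-1 = - 'i :> R[i].
    have i0 : 'i != 0 :> R[i] by rewrite eq_complex/= oner_eq0 andbF.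
    by apply: (mulIf i0); rewrite mulVf// mulNr i2 opprK.
  have := eqn u y t u0; rewrite iV -/T -/(v y) -/(psi' y) => eq1.
  have -> : T^-1 * pm y = T^-1 * Psi_m u y t * E y by rewrite pmE mulrA.
  rewrite -eq1 ppE /D; set P := Psi_p u y t; set e := E y.
  transitivity (u * (P * e) - 'i * eps%:C * A * (P * e) + (v y)%:C * (P * e)).
    by rewrite iA; ring.
  by ring.
have Lpp := ccontinuous_L2 (Cn_continuous (Cpp 0%N)).
have Lpm := ccontinuous_L2 (Cn_continuous (Cpm 0%N)).
have LD := ccontinuous_L2 (Cn_continuous (CD 0%N)).
have negp j : bracket (mode (Negz j)) pp = 0 by rewrite fp.
have Hpp : Hardy pp by apply: fourier_Hardy.
have HD : Hardy D.
  by apply: fourier_Hardy => // j; rewrite fD negp mulr0.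
have H1 : Hardy (fun=> 1 : R[i]).
  by have := Hardy_horner (1%:P : {poly R[i]}); under eq_fun do rewrite hornerC.
(* By [vpp], v f = T (u pp - i eps D) - pm. The first part is in the Hardy space and pm projects to
   1, which dictates p; d is -i f', with coefficients h times those of f. The derivative terms
   cancel and u f - l is identically 1. *)
pose f y := T * pp y.
pose d y := T * (- 'i) * D y.
pose p y := T * (u * pp y - 'i * eps%:C * D y) - 1.
pose l y := - eps%:C * d y + p y.
have Hf : Hardy f by exact: HardyZ.
have Hd : Hardy d by exact: HardyZ.
have Hp : Hardy p.
  exact: HardyB (HardyZ _ (HardyB (HardyZ _ Hpp) (HardyZ _ HD))) H1.
have Hl : Hardy l by exact: HardyD (HardyZ _ Hd) Hp.
(* This splitting gives both the square integrability of v f and its projection: 1 - pm has no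
   nonnegative modes. *)
have vf : mult_op v f = (fun y => p y + (1 - pm y)).
  apply/funext => y; have e : T * (T^-1 * pm y) = pm y by rewrite mulrA mulfV ?mul1r.
  by rewrite /mult_op /f mulrCA vpp /p -{2}e; ring.
have L1 : L2_circle (fun=> 1 : R[i]) by exact: L2_circle_cst.
have Lbul : L_bullet eps v f l.
  exists d, p; split => //; last by apply: aeW.
  - split => // h; rewrite !bracketZr//; try exact: L2_ket.
    rewrite ketE fD.
    have i2 : 'i * 'i = -1 :> R[i] by apply: complex_ext; rewrite !reimE/=; ring.
    have hC : (h%:~R : R)%:C = h%:R :> R[i] by rewrite -(rmorph_nat (real_complex R)).
    rewrite hC; transitivity (- ('i * 'i) * (h%:R * (T * bracket (mode h) pp))).
      by ring.
    by rewrite i2 opprK mul1r.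
  - split => //.
      by rewrite vf; apply: L2_circleD; [exact: Hardy_L2|exact: L2_circleB].
    move=> k Hk; rewrite vf.
    transitivity (bracket k (fun y => 1 - pm y)).
      by apply: circle_mean_ext => y _; congr (_ * _); ring.
    apply: Hardy_orthogonal => //; first exact: L2_circleB.
    move=> h; rewrite bracketBr//; last exact: L2_ket.
    rewrite ketE fm//.
    have -> : (fun=> 1 : R[i]) = @ket R 0 by apply/funext => y; rewrite /ket expr0.
    have [_ o] := orthonormal_ket R.
    by rewrite -ketE o subrr.
have Leq : L2_eq (fun y => u * f y - l y) (@ket R 0).
  apply: aeW => y _; rewrite /f /l /p /d /ket expr0; ring.
have Cf : Cn 2 f by apply: CnM => //; exact: Cn_cst.
have Pf : cperiodic f by move=> y; rewrite /f ppP.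
have negf j : bracket (mode (Negz j)) f = 0.
  by rewrite bracketZr ?negp ?mulr0//; exact: L2_mode.
have lim := @cvg_fourier_sum _ f x Cf Pf negf.
(* The resolvent is an arbitrary representative, but the partial sums see only its brackets, which
   are the Fourier coefficients of the smooth f. *)
have sumE : BA_partial_sum eps v u (cis x) = (fun N => fourier_sum f N x).
  apply/funext => N; apply: eq_bigr => h _.
  by rewrite (resolvent_bracket _ u0 (L2_ket _ 0) Lbul Leq).
rewrite /Phi_BA sumE; split; first by apply/cvg_ex; exists (f x).
have : limn (fun N => fourier_sum f N x : R[i]^o) = f x.
  exact: (cvg_lim (@norm_hausdorff _ _) lim).
by [].
Qed.
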